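(* Let $(\Omega,d)$ be a Polish space with its Borel $\sigma$-algebra, let $P$ be a Markov kernel on $\Omega$, and let $1\le p\le 2$. Suppose that: (i) there exist constants $K\in[0,1]$ and $M\ge 0$ such that $W_p(\delta_xP,\delta_yP)\le K\,d(x,y)+M$ for all $x,y\in\Omega$; (ii) there exist constants $A,B\ge 0$ such that $\delta_xP\in T_pH(A,B)$ for all $x\in\Omega$. Let $J,S\ge 0$ and let $\mu_0\in T_pH(J,S)$. Then $$\mu_0P\in T_pH\left(A+K^2J,\;KS+B+M\right).$$ In particular, for every integer $N\ge 1$, $$\mu_0P^N\in T_pH\left(K^{2N}J+A\,\frac{1-K^{2N}}{1-K^2},\;K^NS+(B+M)\frac{1-K^N}{1-K}\right),$$ where, if $K=1$, the quotients $\frac{1-K^N}{1-K}$ and $\frac{1-K^{2N}}{1-K^2}$ are interpreted as $N$.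
   Context: $\mathcal P(\Omega)$ is the set of Borel probability measures on $\Omega$, and $\mathcal P_p(\Omega)$ the subset of those with finite $p$-th moment. $W_p(\mu,\nu)=\inf_{\gamma\in\Gamma(\mu,\nu)}\left(\int d(x,y)^p\,d\gamma(x,y)\right)^{1/p}$, where $\Gamma(\mu,\nu)$ is the set of couplings of $\mu$ and $\nu$. The relative entropy is $\mathcal H(\mu\,|\,\pi)=\int\log\left(\frac{d\mu}{d\pi}\right)d\mu$ if $\mu\ll\pi$, and $+\infty$ otherwise. For a Markov kernel $P$ and a probability measure $\mu$, $\mu P$ is the law after one step of the chain started from $\mu$, i.e. $\mu P(E)=\int \delta_xP(E)\,d\mu(x)$, where $\delta_x P$ is the transition measure from $x$; $P^N$ is the $N$-fold composition. For $1\le p\le 2$ and constants $A,B\ge0$, a measure $\pi\in\mathcal P_p(\Omega)$ satisfies the defective $p$-transport-entropy inequality with constants $A,B$, written $\pi\in T_pH(A,B)$, if for all $\nu\in\mathcal P(\Omega)$: $W_p(\nu,\pi)\le\sqrt{2A\,\mathcal H(\nu\,|\,\pi)}+B$. *)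

(* Defs.v *)
From HB Require Import structures.
From mathcomp Require Import all_boot all_order all_algebra.
From mathcomp Require Import all_classical all_reals all_analysis.

Set Implicit Arguments.
Unset Strict Implicit.
Unset Printing Implicit Defensive.

Import Order.TTheory GRing.Theory Num.Theory.
Import numFieldNormedType.Exports.

Local Open Scope classical_set_scope.
Local Open Scope ring_scope.

(* Polish metric space: the distance [mdist] is itself complete and separable,
   and the measurable sets are exactly the Borel sets. *)
HB.mixin Record isPolishBorel (R : realType) (d : measure_display) T
    & Measurable d T & Metric R T & Complete T := {
  polish_separable : exists2 D : set T, countable D & dense D ;
  polish_borel : @measurable d T = <<s @open T >>
}.

#[short(type="polishMetricType")]
HB.structure Definition PolishMetric (R : realType) (d : measure_display) :=
  { T of Measurable d T & Metric R T & Complete T & isPolishBorel R d T }.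

Section markov_kernels.
Local Open Scope ereal_scope.
Context {R : realType} d (T : measurableType d).
Implicit Types (P Q : R.-pker T ~> T) (mu : probability T R).

Section transition.
Variables (P : R.-pker T ~> T) (x : T).

Definition transition_def : set T -> \bar R := P x.

HB.instance Definition _ := Measure.copy transition_def (P x).

HB.instance Definition _ := Measure_isProbability.Build _ _ _ transition_def
  (prob_kernel x).

(* The transition measure [\delta_x P]. *)
Definition transition : probability T R := transition_def.

End transition.

Definition kstep_def mu P (E : set T) : \bar R := \int[mu]_x P x E.

Section kstep_probability.
Variables (mu : probability T R) (P : R.-pker T ~> T).

Let kstep0 : kstep_def mu P set0 = 0.
Proof. by rewrite /kstep_def integral0_eq// => x _; rewrite measure0. Qed.

Let kstep_ge0 E : 0 <= kstep_def mu P E.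
Proof. exact: integral_ge0. Qed.

Let kstep_sigma_additive : semi_sigma_additive (kstep_def mu P).
Proof.
move=> F mF tF mUF; rewrite [X in _ --> X](_ : _ =
    \sum_(0 <= i <oo) kstep_def mu P (F i)).
  by apply: is_cvg_ereal_nneg_natsum => n _; exact: kstep_ge0.
rewrite /kstep_def -integral_nneseries//; last first.
  by move=> n; exact: measurable_kernel.
apply: eq_integral => x _.
by apply/esym/cvg_lim => //; exact: measure_semi_sigma_additive.
Qed.

HB.instance Definition _ := isMeasure.Build _ _ _ (kstep_def mu P)
  kstep0 kstep_ge0 kstep_sigma_additive.

Let kstep_setT : kstep_def mu P [set: T] = 1.
Proof.
rewrite /kstep_def (eq_integral (cst 1)) => [|x _]; last exact: prob_kernel.
rewrite integral_cst// mul1e. exact: probability_setT.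
Qed.

HB.instance Definition _ := Measure_isProbability.Build _ _ _ (kstep_def mu P)
  kstep_setT.

(* The law [\mu P] after one step of [P] started from [mu]. *)
Definition kstep : probability T R := kstep_def mu P.

End kstep_probability.

Section kcomp_pker.
Variables P Q : R.-pker T ~> T.

Definition kcomp_pker_def : T -> {measure set T -> \bar R} :=
  mkcomp_noparam P Q.

HB.instance Definition _ := SubProbabilityKernel.on kcomp_pker_def.

Let kcomp_pker_setT x : kcomp_pker_def x [set: T] = 1.
Proof. exact: (probability_setT (kstep (transition P x) Q)). Qed.

HB.instance Definition _ := isProbabilityKernel.Build _ _ _ _ _
  kcomp_pker_def kcomp_pker_setT.

(* [(x, E) |-> \int Q(y, E) P(x, dy)]: first a [P]-step, then a [Q]-step. *)
Definition kcomp_pker : R.-pker T ~> T := kcomp_pker_def.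

End kcomp_pker.

(* [P^n], with [P^0] the identity kernel. *)
Fixpoint kpow P n : R.-pker T ~> T :=
  if n is m.+1 then kcomp_pker (kpow P m) P
  else kdirac (@measurable_id _ T setT).

End markov_kernels.

Section transport_entropy.
Local Open Scope charge_scope.
Local Open Scope ereal_scope.
Context {R : realType} d (T : polishMetricType R d).
Implicit Types (p A B : R) (mu nu pi : probability T R).

Definition finite_moment p mu : Prop :=
  exists x0 : T, \int[mu]_x ((mdist x0 x) `^ p)%:E < +oo.

Definition coupling mu nu (g : probability (T * T)%type R) : Prop :=
  (forall E, measurable E -> g (E `*` [set: T]) = mu E) /\
  (forall E, measurable E -> g ([set: T] `*` E) = nu E).

Definition wasserstein p mu nu : \bar R :=
  ereal_inf [set (\int[g]_z ((mdist z.1 z.2) `^ p)%:E) `^ p^-1 |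
    g in [set g | coupling mu nu g]].

Definition relative_entropy mu pi : \bar R :=
  if pselect (mu `<< pi) then
    \int[mu]_x lne (('d (charge_of_finite_measure mu) '/d pi) x)
  else +oo.

(* [sqrt (2 A h)], equal to [+oo] at [h = +oo] even if [A = 0]: the convention
   [0 * +oo = 0] of [\bar R] would keep a Dirac mass (on a space with at least
   two points) out of [T_pH(0, 0)]. *)
Definition sqrt_entropy A (h : \bar R) : \bar R :=
  if h == +oo then +oo else (Num.sqrt (2 * A * fine h))%:E.

(* [pi \in T_pH(A, B)], the moment condition [pi \in P_p] included. *)
Definition TpH p A B pi : Prop :=
  finite_moment p pi /\
  forall nu,
    wasserstein p nu pi <= sqrt_entropy A (relative_entropy nu pi) + B%:E.

End transport_entropy.

(* Main.v *)
From HB Require Import structures.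
From mathcomp Require Import all_boot all_order all_algebra.
From mathcomp Require Import all_classical all_reals all_analysis.
From mathcomp Require Import measurable_realfun giry.
From mathcomp Require Import ring lra.
Require Import Defs.
Import Order.TTheory GRing.Theory Num.Theory.
Import numFieldNormedType.Exports.
Set Implicit Arguments.
Unset Strict Implicit.
Unset Printing Implicit Defensive.
Local Open Scope classical_set_scope.
Local Open Scope ring_scope.

(** Only finite entropies matter, so let [nu] have a density [f] with respect
    to [mu0 P]. The joint law [f(y) mu0(dx) P(x, dy)] has first marginal
    [nu0 = m mu0], where [m x] is the integral of [f] against [delta_x P], and
    conditional laws [Q x = (f / m x) delta_x P]; hence [nu = nu0 Q]. The chain
    rule [entropy_disintegration] splits the entropy of [nu] into
    [e0 = H(nu0 | mu0)] and [e1], the [nu0]-average of [H(Q x | delta_x P)].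

    The transport from [nu0 Q] to [mu0 P] goes through [nu0 P]. The leg from
    [nu0 Q] to [nu0 P] costs at most the [L^p(nu0)] norm of
    [sqrt (2 A H(Q x | delta_x P)) + B], which is at most [sqrt (2 A e1) + B]
    by Minkowski and by Jensen, the latter because [p <= 2]. The leg from
    [nu0 P] to [mu0 P] costs at most [K W_p(nu0, mu0) + M], which is at most
    [K sqrt (2 J e0) + K S + M]. The two square roots combine by
    Cauchy-Schwarz ([sqrt_cauchy_schwarz]), which gives the constants of one
    step ([TpH_step]); the bound for [N] steps is a geometric recursion.

    Mixing the optimal couplings of the pairs [(Q x, delta_x P)] and gluing the
    two legs would require a measurable choice of couplings and their
    disintegration. Both are avoided by reasoning on the dual side. The cost
    is bounded by [C ^ p] as soon as every pair of bounded functions with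
    [f x + g y <= d(x, y) ^ p + c] has integrals adding up to at most
    [C ^ p + c] ([wasserstein_le_dual]). Bounds of this kind are integrated
    over [x] without any choice ([wasserstein_dual_le] is the elementary
    converse), and two legs are chained by inserting the inf-convolution of
    [f] with the cost as an intermediate potential ([inf_convolution],
    [wasserstein_mixture_le]). The constant [c] lets all functions be taken
    nonnegative, so that extended integrals add up unconditionally.

    A coupling is thus constructed only once, in [wasserstein_le_dual]: the
    space is cut into finitely many cells of small diameter and a remainder
    that is negligible for the [p]-th moments, the finite transport problem
    between the cells is solved by Farkas' lemma
    ([finite_transport_duality]), and the finite plan is spread over the cells
    by a density with respect to the product measure ([cell_coupling]). *)

(** * Farkas' lemma and finite transport duality *)

Section farkas.
Context {F : realFieldType} {E K : finType}.
Implicit Types (y b : E -> F) (v : K -> E -> F).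

Let dot y b := \sum_e y e * b e.

Let dotBl y z (c : F) b :
  dot (fun e => y e - c * z e) b = dot y b - c * dot z b.
Proof.
by rewrite /dot mulr_sumr -sumrB; apply: eq_bigr => e _; rewrite mulrBl mulrA.
Qed.

Let dotBr y b (c : F) w :
  dot y (fun e => b e - c * w e) = dot y b - c * dot y w.
Proof.
rewrite /dot mulr_sumr -sumrB; apply: eq_bigr => e _.
by rewrite mulrBr mulrCA.
Qed.

(** Induction on the generators. If [b] lies neither in the cone of [s] nor on
    the wrong side of a functional [y] that also works for the new generator
    [v k0], then [y] is positive on [v k0]; projecting along [v k0] onto the
    kernel of [y] removes that generator, and both alternatives lift back. *)
Lemma farkas_seq (s : seq K) v b : uniq s ->
  (exists2 c : K -> F, (forall k, 0 <= c k) &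
     forall e, b e = \sum_(k <- s) c k * v k e) \/
  (exists2 y, (forall k, k \in s -> dot y (v k) <= 0) & 0 < dot y b).
Proof.
elim: s v b => [|k0 s IH] v b /=.
  move=> _; have [/forallP b0|] := boolP [forall e, b e == 0].
    by left; exists (fun=> 0) => // e; rewrite big_nil; exact/eqP.
  rewrite negb_forall => /existsP[e0 be0]; right; exists b => //.
  rewrite /dot (bigD1 e0)//= ltr_pwDl//.
    by rewrite -expr2 exprn_even_gt0.
  by apply: sumr_ge0 => e _; rewrite -expr2 sqr_ge0.
case/andP=> k0s us.
have sE (c : K -> F) c0 e :
    \sum_(k <- k0 :: s) (if k == k0 then c0 else c k) * v k e =
    c0 * v k0 e + \sum_(k <- s) c k * v k e.
  rewrite big_cons eqxx; congr (_ + _); apply: eq_big_seq => k ks.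
  by case: eqP k0s => // <-; rewrite ks.
have [[c c0 bE]|[y ys yb]] := IH v b us.
  left; exists (fun k => if k == k0 then 0 else c k) => [k|e].
    by case: ifP.
  by rewrite sE mul0r add0r.
have [yk0|yk0] := leP (dot y (v k0)) 0.
  by right; exists y => // k; rewrite inE => /orP[/eqP->|/ys].
(* [w - r w * v k0] is the projection of [w] on the hyperplane [dot y = 0] *)
pose r w := dot y w / dot y (v k0).
have [[c c0 bE]|[z zs zb]] :=
    IH (fun k e => v k e - r (v k) * v k0 e) (fun e => b e - r b * v k0 e) us.
  left; exists (fun k => if k == k0 then r b - \sum_(j <- s) c j * r (v j)
                         else c k) => [k|e].
    case: ifP => // _; rewrite subr_ge0 (@le_trans _ _ 0)//; last first.
      by rewrite divr_ge0// ltW.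
    rewrite big_seq sumr_le0// => j js.
    by rewrite mulr_ge0_le0// mulr_le0_ge0 ?ys// invr_ge0 ltW.
  move: (bE e); under [X in _ = X]eq_bigr do rewrite mulrBr mulrA.
  rewrite sumrB -mulr_suml sE => /eqP; rewrite subr_eq => /eqP ->.
  by rewrite mulrBl addrC addrA addrAC.
right; exists (fun e => z e - dot z (v k0) / dot y (v k0) * y e).
  move=> k; rewrite inE dotBl => /orP[/eqP->|/zs].
    by rewrite divfK ?subrr// gt_eqF.
  by rewrite dotBr /r mulrAC -mulrA mulrC.
by move: zb; rewrite dotBl dotBr /r mulrAC -mulrA mulrC.
Qed.

Lemma farkas v b :
  (exists2 c : K -> F, (forall k, 0 <= c k) &
     forall e, b e = \sum_k c k * v k e) \/
  (exists2 y, (forall k, \sum_e y e * v k e <= 0) & 0 < \sum_e y e * b e).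
Proof.
have [[c c0 bE]|[y yv yb]] := @farkas_seq (index_enum K) v b (index_enum_uniq _).
  by left; exists c.
by right; exists y => // k; apply: yv; exact: mem_index_enum.
Qed.

End farkas.

(** Farkas' lemma in dimension [I + J + 1]: a generator per pair [(i, j)]
    carries the two marginal constraints and the cost, and one slack generator
    turns the bound [C] on the cost into an equation. A separating functional
    is a pair of potentials for [s * c]; for [s > 0] it is rescaled, and for
    [s = 0] it contradicts that both marginals have mass one. *)
Lemma finite_transport_duality (F : realFieldType) (I J : finType)
    (a : I -> F) (b : J -> F) (c : I -> J -> F) (C : F) :
  (forall i, 0 <= a i) -> (forall j, 0 <= b j) ->
  \sum_i a i = 1 -> \sum_j b j = 1 ->
  (forall (u : I -> F) (v : J -> F), (forall i j, u i + v j <= c i j) ->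
     \sum_i u i * a i + \sum_j v j * b j <= C) ->
  exists g : I -> J -> F,
    [/\ forall i j, 0 <= g i j,
        forall i, \sum_j g i j = a i,
        forall j, \sum_i g i j = b j &
        \sum_i \sum_j g i j * c i j <= C].
Proof.
move=> a0 b0 a1 b1 dualC.
pose E := ((I + J) + unit)%type; pose K := (I * J + unit)%type.
pose v (k : K) (e : E) : F := match k, e with
  | inl ij, inl (inl i) => (ij.1 == i)%:R
  | inl ij, inl (inr j) => (ij.2 == j)%:R
  | inl ij, inr _ => c ij.1 ij.2
  | inr _, inr _ => 1
  | inr _, inl _ => 0 end.
pose t (e : E) : F := match e with
  | inl (inl i) => a i | inl (inr j) => b j | inr _ => C end.
have bigu (f : unit -> F) : \sum_e f e = f tt.
  by rewrite (bigD1 tt)//= big1 ?addr0// => -[].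
have bigd (U : finType) (f : U -> F) (x : U) : \sum_y f y * (x == y)%:R = f x.
  rewrite (bigD1 x)//= eqxx mulr1 big1 ?addr0// => y.
  by rewrite eq_sym => /negPf->; rewrite mulr0.
have pairE (f : I * J -> F) : \sum_ij f ij = \sum_i \sum_j f (i, j).
  by rewrite pair_bigA; apply: eq_bigr => -[].
have [[g g0 gE]|[y yv yt]] := @farkas F E K v t.
  exists (fun i j => g (inl (i, j))); split=> [i j|i|j|].
  - exact: g0.
  - move: (gE (inl (inl i))); rewrite big_sumType/= bigu mulr0 addr0 => ->.
    rewrite pairE/=.
    rewrite (bigD1 i)//= [X in _ = _ + X]big1 ?addr0.
      by apply: eq_bigr => j _; rewrite eqxx mulr1.
    by move=> i' /negPf ni; rewrite big1// => j _; rewrite ni mulr0.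
  - move: (gE (inl (inr j))); rewrite big_sumType/= bigu mulr0 addr0 => ->.
    rewrite pairE/=.
    apply: eq_bigr => i _; rewrite -[LHS](bigd _ (fun j => g (inl (i, j)))).
    by apply: eq_bigr => j' _; rewrite eq_sym.
  - move: (gE (inr tt)); rewrite big_sumType/= bigu mulr1 => ->.
    by rewrite pairE/= lerDl g0.
pose u i := y (inl (inl i)); pose w j := y (inl (inr j)); pose s := - y (inr tt).
have uws i j : u i + w j <= s * c i j.
  have := yv (inl (i, j)); rewrite !big_sumType/= bigu.
  under [X in X + _ + _]eq_bigr do [].
  by rewrite !bigd /u /w /s /=; lra.
have s0 : 0 <= s.
  have := yv (inr tt); rewrite !big_sumType/= bigu.
  under eq_bigr do rewrite mulr0; under [X in _ + X + _]eq_bigr do rewrite mulr0.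
  by rewrite !big1// /s; lra.
have pos : s * C < \sum_i u i * a i + \sum_j w j * b j.
  by move: yt; rewrite !big_sumType/= bigu /u /w /s; lra.
exfalso; move: s0; rewrite le_eqVlt => /orP[/eqP s0|s0].
  have : \sum_i u i * a i + \sum_j w j * b j <= 0.
    have -> : \sum_i u i * a i + \sum_j w j * b j =
        \sum_i \sum_j (u i + w j) * (a i * b j).
      transitivity (\sum_i \sum_j (u i * a i * b j + w j * b j * a i)).
        under [RHS]eq_bigr do rewrite big_split/= -mulr_sumr -mulr_suml b1 mulr1.
        by rewrite big_split/= -mulr_sumr a1 mulr1.
      by apply: eq_bigr => i _; apply: eq_bigr => j _; ring.
    apply: sumr_le0 => i _; apply: sumr_le0 => j _.
    by rewrite mulr_le0_ge0 ?mulr_ge0//; have := uws i j; rewrite -s0 mul0r.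
  by apply/negP; rewrite -ltNge; move: pos; rewrite -s0 mul0r.
have /dualC : forall i j, u i / s + w j / s <= c i j.
  by move=> i j; rewrite -mulrDl ler_pdivrMr// mulrC.
apply/negP; rewrite -ltNge -(ltr_pM2l s0) (lt_le_trans pos)// le_eqVlt.
apply/orP; left; apply/eqP; rewrite mulrDr !mulr_sumr; congr (_ + _);
  by apply: eq_bigr => i _; field; rewrite gt_eqF.
Qed.

(** * Densities and mixtures of probability measures *)

Lemma integral_probability_cst {R : realType} d (T : measurableType d)
  (m : probability T R) (c : R) : (\int[m]_x c%:E = c%:E)%E.
Proof.
rewrite integral_cst// -[RHS]mule1; congr mule; exact: probability_setT.
Qed.

Section density.
Local Open Scope ereal_scope.
Context {R : realType} d (T : measurableType d).
Variables (mu : probability T R) (f : T -> R).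

Section construction.
Hypotheses (mf : measurable_fun setT f) (f0 : forall x, (0 <= f x)%R).
Hypothesis f1 : \int[mu]_x (f x)%:E = 1.

(** The hypotheses are arguments so that the measure can carry a canonical
    probability structure. *)
Definition density_def of measurable_fun setT f & (forall x, (0 <= f x)%R) &
  \int[mu]_x (f x)%:E = 1 := fun E : set T => \int[mu]_(x in E) (f x)%:E.

Let rho := density_def mf f0 f1.

Let rho0 : rho set0 = 0. Proof. exact: integral_set0. Qed.

Let rho_ge0 E : 0 <= rho E.
Proof. by apply: integral_ge0 => x _; rewrite lee_fin. Qed.

Let rho_sigma_additive : semi_sigma_additive rho.
Proof.
apply: semi_sigma_additive_nng_induced; first exact/measurable_EFinP.
by move=> x; rewrite lee_fin.
Qed.

HB.instance Definition _ := isMeasure.Build _ _ _ rho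
  rho0 rho_ge0 rho_sigma_additive.

HB.instance Definition _ := Measure_isProbability.Build _ _ _ rho f1.

Definition density : probability T R := rho.

End construction.

Section change_of_measure.
Variable nu : probability T R.
Hypothesis mf : measurable_fun setT f.
Hypothesis nuE : forall E, measurable E -> nu E = \int[mu]_(x in E) (f x)%:E.

Lemma density_dominates : nu `<< mu.
Proof.
apply/null_content_dominatesP => //= E mE muE; rewrite nuE//.
apply: null_set_integral => //.
by apply/measurable_EFinP; exact: measurable_funTS.
Qed.

(** By uniqueness, [f] is almost everywhere the Radon-Nikodym derivative of
    [nu], for which the change of variables is known. *)
Lemma integral_density (h : T -> \bar R) : measurable_fun setT h ->
  (forall x, 0 <= h x) -> \int[nu]_x h x = \int[mu]_x (h x * (f x)%:E).
Proof.
move=> mh h0.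
have mg : measurable_fun setT (Radon_Nikodym_SigmaFinite.f nu mu).
  exact: measurable_int (Radon_Nikodym_SigmaFinite.f_integrable density_dominates).
rewrite -(Radon_Nikodym_SigmaFinite.change_of_variables density_dominates)//.
apply: ae_eq_integral => //.
- exact: emeasurable_funM.
- by apply: emeasurable_funM => //; exact/measurable_EFinP.
apply: ae_eqe_mul2l; apply: integral_ae_eq => //.
- exact: Radon_Nikodym_SigmaFinite.f_integrable density_dominates.
- exact/measurable_EFinP.
- move=> E _ mE; rewrite -nuE// -Radon_Nikodym_SigmaFinite.f_integral//.
  exact: density_dominates.
Qed.

End change_of_measure.
End density.

Section real_integrals.
Local Open Scope ereal_scope.
Context {R : realType} d (T : measurableType d).
Variables (mu : {measure set T -> \bar R}).
Implicit Types f g : T -> R.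

Lemma integral_addr_EFin f g :
  measurable_fun setT f -> measurable_fun setT g ->
  (forall x, 0 <= f x)%R -> (forall x, 0 <= g x)%R ->
  \int[mu]_x (f x + g x)%:E = \int[mu]_x (f x)%:E + \int[mu]_x (g x)%:E.
Proof.
move=> mf mg f0 g0; under eq_integral do rewrite EFinD.
rewrite ge0_integralD//; [|exact/measurable_EFinP| |exact/measurable_EFinP];
  by move=> x _; rewrite lee_fin.
Qed.

Lemma integral_mulr_EFin (c : R) f : (0 <= c)%R -> measurable_fun setT f ->
  (forall x, 0 <= f x)%R ->
  \int[mu]_x (c * f x)%:E = c%:E * \int[mu]_x (f x)%:E.
Proof.
move=> c0 mf f0; under eq_integral do rewrite EFinM.
rewrite ge0_integralZl//; [exact/measurable_EFinP|].
by move=> x _; rewrite lee_fin.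
Qed.

End real_integrals.

(** A law that agrees with [mu P] on measurable sets is the bind of [mu] along
    [P] in the Giry monad. *)
Section kernel_mixture.
Local Open Scope ereal_scope.
Context {R : realType} d (T : measurableType d).
Variables (P : R.-pker T ~> T) (mu pi : probability T R).
Hypothesis piE : forall E, measurable E -> pi E = \int[mu]_x P x E.

Let giry_transition (x : T) : giry T R := transition P x.

Let measurable_giry_transition : measurable_fun setT giry_transition.
Proof.
by apply: measurable_giry_codensity => // E mE; exact: measurable_kernel.
Qed.

Lemma measurable_integral_transition (h : T -> \bar R) :
  measurable_fun setT h -> (forall x, 0 <= h x) ->
  measurable_fun setT (fun x => \int[transition P x]_y h y).
Proof.
move=> mh h0.
exact: measurableT_comp (measurable_giry_int mh h0) measurable_giry_transition.
Qed.

Lemma integral_kernel_mixture (h : T -> \bar R) :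
  measurable_fun setT h -> (forall x, 0 <= h x) ->
  \int[pi]_y h y = \int[mu]_x \int[transition P x]_y h y.
Proof.
move=> mh h0.
have bindE k : measurable_fun setT k -> (forall x, 0 <= k x) ->
    \int[giry_bind mu measurable_giry_transition]_y k y =
    \int[mu]_x \int[transition P x]_y k y.
  by move=> mk k0; exact: giry_int_bind.
rewrite -bindE//; apply: eq_measure_integral => E mE _.
transitivity (\int[giry_bind mu measurable_giry_transition]_y (\1_E y)%:E).
  rewrite bindE//; last exact/measurable_EFinP.
  apply: etrans (piE mE) _; apply: eq_integral => x _.
  by rewrite integral_indic// setIT.
by rewrite integral_indic// setIT.
Qed.

End kernel_mixture.

(** * Relative entropy and its chain rule along a kernel *)

Section entropy_function.
Context {R : realType}.
Implicit Types t m : R.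

(** The relative entropy of a density is usually the integral of [t * ln t].
    Adding [1 - t], which integrates to zero, makes the integrand nonnegative,
    so that the integrals below always make sense. *)
Definition kl_fun t := t * ln t - t + 1.

Lemma maxr0B t : Num.max t 0 - Num.max (- t) 0 = t.
Proof. by case: (leP t 0); case: (leP (- t) 0); lra. Qed.

Lemma oppr_mul_ln_le t : 0 < t -> - (t * ln t) <= 1 - t.
Proof.
move=> t0; have V0 : 0 < t^-1 by rewrite invr_gt0.
have : ln (1 + (t^-1 - 1)) <= t^-1 - 1 by rewrite le_ln1Dx; lra.
rewrite addrC subrK lnV ?posrE// -(ler_pM2l t0) mulrBr divff ?gt_eqF//.
by rewrite mulr1 mulrN.
Qed.

Lemma kl_fun_ge0 t : 0 <= t -> 0 <= kl_fun t.
Proof.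
rewrite le_eqVlt => /predU1P[<-|/oppr_mul_ln_le]; rewrite /kl_fun; last by lra.
by rewrite mul0r; lra.
Qed.

(** This pointwise identity is the chain rule: when [t] is a density of mean
    [m], the middle term has mean zero and [t / m] is the normalized density. *)
Lemma kl_funD t m : 0 <= t -> 0 < m ->
  kl_fun t = m * kl_fun (t / m) + ln m * (t - m) + kl_fun m.
Proof.
move=> + m0; rewrite le_eqVlt /kl_fun => /predU1P[<-|t0].
  by rewrite !mul0r; ring.
by rewrite ln_div ?posrE//; field; rewrite gt_eqF.
Qed.

Lemma measurable_kl_fun : measurable_fun setT kl_fun.
Proof.
apply: measurable_funD => //; apply: measurable_funB => //.
exact: measurable_funM.
Qed.

End entropy_function.

Section relative_entropy_density.
Local Open Scope charge_scope.
Local Open Scope ereal_scope.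
Context {R : realType} d (T : polishMetricType R d).
Variables (nu pi : probability T R) (f : T -> R).
Hypotheses (mf : measurable_fun setT f) (f0 : forall x, (0 <= f x)%R).
Hypothesis nuE : forall E, measurable E -> nu E = \int[pi]_(x in E) (f x)%:E.

(** The positive and negative parts of [ln f] are integrated separately; the
    negative one is finite because [- t * ln t <= 1 - t]. *)
Lemma relative_entropy_density :
  relative_entropy nu pi = \int[pi]_x (kl_fun (f x))%:E.
Proof.
have nupi : nu `<< pi by exact: density_dominates mf nuE.
rewrite /relative_entropy; case: pselect => // nupi'; rewrite [LHS]/=.
set g := ('d _ '/d _).
have gfin x : g x \is a fin_num by exact: Radon_Nikodym_fin_num.
have mg : measurable_fun setT g.
  exact/(measurable_int pi)/Radon_Nikodym_integrable.
have gf : ae_eq nu setT g (EFin \o f).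
  apply: (null_dominates_ae_eq measurableT nupi).
  apply: integral_ae_eq => //.
  - exact: Radon_Nikodym_integrable.
  - exact/measurable_EFinP.
  - by move=> E _ mE; rewrite -Radon_Nikodym_integral//; exact: nuE.
have f_gt0 : {ae nu, forall x, (0 < f x)%R}.
  exists (f @^-1` `]-oo, 0%R]); split.
  - by rewrite -[X in measurable X]setTI; exact: mf.
  - rewrite nuE; last by rewrite -[X in measurable X]setTI; exact: mf.
    rewrite integral0_eq// => x /=; rewrite in_itv/= => fx.
    by congr EFin; apply/eqP; rewrite eq_le fx f0.
  - by move=> x /= /negP; rewrite -leNgt in_itv.
have mln : measurable_fun setT (fun x => (ln (f x))%:E).
  by apply/measurable_EFinP; exact: measurableT_comp.
rewrite (ae_eq_integral (fun x => (ln (f x))%:E))//; last 2 first.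
- pose h x := if (fine (g x) <= 0)%R then -oo else (ln (fine (g x)))%:E.
  have -> : (fun x => lne (g x)) = h.
    by apply/funext => x; rewrite /h -{1}(fineK (gfin x)).
  have mfg : measurable_fun setT (fine \o g) by exact: measurableT_comp.
  apply: measurable_fun_ifT => //.
    exact: measurable_fun_ler.
  by apply/measurable_EFinP; exact: measurableT_comp.
- apply: filterS2 gf f_gt0 => x /= /(_ I) -> fx0 _.
  by rewrite /= leNgt fx0.
rewrite integralE.
have intM (h : T -> R) : measurable_fun setT h -> (forall x, (0 <= h x)%R) ->
    \int[nu]_x (h x)%:E = \int[pi]_x (h x * f x)%:E.
  move=> mh h0; rewrite (integral_density mf nuE)//.
  exact/measurable_EFinP.
have mlnr : measurable_fun setT (fun x => ln (f x)).
  exact: measurableT_comp.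
have -> : \int[nu]_x (fun x => (ln (f x))%:E)^\+ x =
    \int[pi]_x (Num.max (ln (f x)) 0 * f x)%:E.
  rewrite -intM//; first by apply: eq_integral => x _; rewrite funeposE EFin_max.
  - exact: measurable_maxr.
  - by move=> x; rewrite le_max lexx orbT.
have -> : \int[nu]_x (fun x => (ln (f x))%:E)^\- x =
    \int[pi]_x (Num.max (- ln (f x)) 0 * f x)%:E.
  rewrite -intM//; first by apply: eq_integral => x _; rewrite funenegE EFin_max.
  - by apply: measurable_maxr => //; exact: measurable_funN.
  - by move=> x; rewrite le_max lexx orbT.
set p := \int[pi]_x (Num.max (ln _) 0 * _)%:E.
set n := \int[pi]_x (Num.max (- _) 0 * _)%:E.
have mp : measurable_fun setT (fun x => Num.max (ln (f x)) 0 * f x)%R.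
  by apply: measurable_funM => //; exact: measurable_maxr.
have mn : measurable_fun setT (fun x => Num.max (- ln (f x)) 0 * f x)%R.
  by apply: measurable_funM => //; apply: measurable_maxr => //;
    exact: measurable_funN.
have mphi : measurable_fun setT (fun x => kl_fun (f x)).
  exact: measurableT_comp measurable_kl_fun mf.
have p0 x : (0 <= Num.max (ln (f x)) 0 * f x)%R.
  by rewrite mulr_ge0// le_max lexx orbT.
have n0 x : (0 <= Num.max (- ln (f x)) 0 * f x)%R.
  by rewrite mulr_ge0// le_max lexx orbT.
have int1 : \int[pi]_x 1 = 1 by exact: integral_probability_cst.
have nfin : n \is a fin_num.
  rewrite ge0_fin_numE; last by apply: integral_ge0 => x _; rewrite lee_fin.
  apply: (@le_lt_trans _ _ 1); last by rewrite ltry.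
  rewrite -int1; apply: ge0_le_integral => //.
  - by move=> x _; rewrite lee_fin.
  - exact/measurable_EFinP.
  - move=> x _; rewrite lee_fin maxr_pMl// mul0r ge_max ler01 andbT.
    have := f0 x; rewrite le_eqVlt => /predU1P[<-|fx0].
      by rewrite mulr0 ler01.
    by have := oppr_mul_ln_le fx0; have := f0 x; lra.
have phif0 x : (0 <= kl_fun (f x))%R by exact: kl_fun_ge0.
have fint : \int[pi]_x (f x)%:E = 1.
  by rewrite -nuE//; exact: probability_setT.
have pE : p + 1 = \int[pi]_x (kl_fun (f x))%:E + 1 + n.
  rewrite -{1}int1 -{2}fint -!integral_addr_EFin//; last 2 first.
  - exact: measurable_funD.
  - by move=> x; rewrite addr_ge0.
  apply: eq_integral => x _; congr EFin; rewrite /kl_fun.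
  by rewrite -[X in (f x * X)%R]maxr0B; ring.
have I0 : 0 <= \int[pi]_x (kl_fun (f x))%:E.
  by apply: integral_ge0 => x _; rewrite lee_fin.
have P0 : 0 <= p by apply: integral_ge0 => x _; rewrite lee_fin.
move: pE I0 P0 nfin.
case: p => [p| |]; case: (n) => [n'| |]; case: (\int[pi]_x _) => [I| |] //=.
by move=> [h] _ _ _; congr EFin; lra.
Qed.

End relative_entropy_density.

Section entropy_conditioning.
Local Open Scope ereal_scope.
Context {R : realType} d (T : measurableType d).
Variables (mu : probability T R) (f : T -> R).
Hypotheses (mf : measurable_fun setT f) (f0 : forall x, (0 <= f x)%R).

(** The integrated form of [kl_funD]. For [m = 0] the density vanishes almost
    everywhere and [kl_fun 0 = 1] is what remains. *)
Lemma entropy_normalize (m : R) : (0 <= m)%R ->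
  \int[mu]_x (f x)%:E = m%:E ->
  m%:E * \int[mu]_x (kl_fun (f x / m))%:E + (kl_fun m)%:E <=
  \int[mu]_x (kl_fun (f x))%:E.
Proof.
move=> m_ge0 fm.
have mphi c : measurable_fun setT (fun x => kl_fun (f x / c)).
  by apply: measurableT_comp measurable_kl_fun _; exact: measurable_funM.
have mphi1 : measurable_fun setT (fun x => kl_fun (f x)).
  exact: measurableT_comp measurable_kl_fun mf.
have int1 : \int[mu]_x 1 = 1 by exact: integral_probability_cst.
move: m_ge0; rewrite le_eqVlt => /predU1P[m0|m_gt0].
  rewrite -m0 mul0e add0e {1}/kl_fun mul0r subr0 add0r -int1.
  apply: ae_ge0_le_integral => //.
  - by move=> x _; rewrite lee_fin kl_fun_ge0.
  - exact/measurable_EFinP.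
  have : ae_eq mu setT (EFin \o f) (cst 0).
    apply/(ae_eq_integral_abs _ measurableT); first exact/measurable_EFinP.
    by under eq_integral do rewrite /= ger0_norm//; rewrite fm -m0.
  apply: filterS => x /(_ I) [->] _.
  by rewrite lee_fin /kl_fun mul0r; lra.
(* the sign of [ln m] is unknown: both sides are first made nonnegative *)
pose a : R := Num.max (ln m) 0%R; pose b : R := Num.max (- ln m)%R 0%R.
have a0 : (0 <= a)%R by rewrite le_max lexx orbT.
have b0 : (0 <= b)%R by rewrite le_max lexx orbT.
have ab : (a - b = ln m)%R by exact: maxr0B.
have pm0 := kl_fun_ge0 (ltW m_gt0).
have pf0 x := kl_fun_ge0 (f0 x).
have pfm0 x : (0 <= kl_fun (f x / m))%R by rewrite kl_fun_ge0// divr_ge0// ltW.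
have m_ge0 := ltW m_gt0.
have key (F G : T -> R) (c : R) : measurable_fun setT F ->
    measurable_fun setT G -> (forall x, (0 <= F x)%R) ->
    (forall x, (0 <= G x)%R) -> (0 <= c)%R ->
    (forall x, F x + (a * m + b * f x) = m * G x + (c + (a * f x + b * m)))%R ->
    m%:E * \int[mu]_x (G x)%:E + c%:E = \int[mu]_x (F x)%:E.
  move=> mF mG F0 G0 c0 FG.
  have : \int[mu]_x (F x + (a * m + b * f x))%:E =
      \int[mu]_x (m * G x + (c + (a * f x + b * m)))%:E.
    by apply: eq_integral => x _; rewrite FG.
  rewrite !integral_addr_EFin//; try by
    [move=> x; rewrite ?addr_ge0 ?mulr_ge0|
     repeat (apply: measurable_funD => // || apply: measurable_funM => //)].
  rewrite !integral_mulr_EFin// !integral_probability_cst fm => IE.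
  have := congr1 (fun z => z - (a * m + b * m)%:E) IE.
  rewrite !EFinD !EFinM addeK// => ->.
  by rewrite addeA addeK.
by rewrite (@key (fun x => kl_fun (f x))) // => x; rewrite (kl_funD (f0 x) m_gt0) -ab; ring.
Qed.

End entropy_conditioning.

Section entropy_disintegration.
Local Open Scope ereal_scope.
Context {R : realType} d (T : polishMetricType R d).
Variables (P : R.-pker T ~> T) (mu pi : probability T R).
Hypothesis piE : forall E, measurable E -> pi E = \int[mu]_x P x E.

Lemma entropy_lty_density (nu : probability T R) :
  relative_entropy nu pi < +oo -> exists f : T -> R,
    [/\ measurable_fun setT f, forall x, (0 <= f x)%R &
        forall E, measurable E -> nu E = \int[pi]_(x in E) (f x)%:E].
Proof.
rewrite /relative_entropy; case: pselect => nupi /=; last by rewrite ltxx.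
move=> _.
have ffin := Radon_Nikodym_SigmaFinite.f_fin_num nupi.
exists (fine \o Radon_Nikodym_SigmaFinite.f nu pi); split.
- apply: measurableT_comp => //.
  exact: measurable_int (Radon_Nikodym_SigmaFinite.f_integrable nupi).
- by move=> x; rewrite fine_ge0// Radon_Nikodym_SigmaFinite.f_ge0.
- move=> E mE; rewrite (Radon_Nikodym_SigmaFinite.f_integral nupi)//.
  by apply: eq_integral => x _; rewrite /= fineK.
Qed.

(** The chain rule. With [m x] the mean of the density [f] under
    [delta_x P], one takes [nu0 = m mu] and [Q x = (f / m x) delta_x P]; both
    are given by formulas, so that the identity [nu = nu0 Q] is Fubini's
    theorem. The values of [x] where [m x] is [0] or infinite are null for
    [nu0], and [Q x] is [delta_x P] there. *)
Lemma entropy_disintegration (nu : probability T R) :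
  relative_entropy nu pi < +oo ->
  exists (nu0 : probability T R) (Q : T -> probability T R) (h : T -> R)
    (e0 e1 : R),
    [/\ relative_entropy nu0 mu = e0%:E,
        [/\ measurable_fun setT h, forall x, (0 <= h x)%R &
            \int[nu0]_x (h x)%:E = e1%:E],
        [/\ (0 <= e0)%R, (0 <= e1)%R & (e0 + e1)%:E <= relative_entropy nu pi],
        {ae nu0, forall x, relative_entropy (Q x) (transition P x) = (h x)%:E} &
        forall k : T -> \bar R, measurable_fun setT k -> (forall x, 0 <= k x) ->
          measurable_fun setT (fun x => \int[Q x]_y k y) /\
          \int[nu]_y k y = \int[nu0]_x \int[Q x]_y k y].
Proof.
move=> Hfin; have [f [mf f0 nuE]] := entropy_lty_density Hfin.
move: Hfin; rewrite (relative_entropy_density mf f0 nuE) => Hfin.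
have mfE : measurable_fun setT (EFin \o f) by exact/measurable_EFinP.
have f0E x : 0 <= (f x)%:E by rewrite lee_fin.
pose m x := \int[transition P x]_y (f y)%:E.
have m0 x : 0 <= m x by exact: integral_ge0.
have mm : measurable_fun setT m by exact: measurable_integral_transition.
pose m1 x := fine (m x).
have m10 x : (0 <= m1 x)%R by exact: fine_ge0.
have mm1 : measurable_fun setT m1 by exact: measurableT_comp mm.
have mm1E : measurable_fun setT (EFin \o m1) by exact/measurable_EFinP.
have intm : \int[mu]_x m x = 1.
  rewrite -(integral_kernel_mixture piE)// -nuE//; exact: probability_setT.
have mfin : {ae mu, forall x, m x = (m1 x)%:E}.
  have : mu.-integrable setT m.
    apply/integrableP; split=> //.
    by under eq_integral do rewrite gee0_abs//; rewrite intm ltry.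
  move/(integrable_ae measurableT); apply: filterS => x /(_ I) mx.
  by rewrite fineK.
have intm1 : \int[mu]_x (m1 x)%:E = 1.
  rewrite -intm; apply: ae_eq_integral => //.
  by apply: filterS mfin => x ->.
pose nu0 := density mm1 m10 intm1.
have nu0E E : measurable E -> nu0 E = \int[mu]_(x in E) (m1 x)%:E by [].
pose good x := (0 < m1 x)%R.
have goodE x : good x -> m x = (m1 x)%:E.
  by rewrite /good /m1; case: (m x) (m0 x) => //=; rewrite ltxx.
have m1P x : good x -> \int[transition P x]_y (f y / m1 x)%:E = 1.
  move=> gx; under eq_integral do rewrite mulrC EFinM.
  rewrite ge0_integralZl_EFin//; last by rewrite invr_ge0.
  by rewrite -/(m x) goodE// -EFinM mulVf// gt_eqF.
have exQ x : exists q : probability T R, if good x then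
    forall E, measurable E ->
      q E = \int[transition P x]_(y in E) (f y / m1 x)%:E
    else q = transition P x.
  have [gx|_] := boolP (good x); last by exists (transition P x).
  have mfm : measurable_fun setT (fun y => f y / m1 x)%R.
    exact: measurable_funM.
  have fm0 y : (0 <= f y / m1 x)%R by rewrite divr_ge0.
  by exists (density mfm fm0 (m1P x gx)).
have {exQ} [Q QP] := choice exQ.
pose hE x := \int[transition P x]_y (kl_fun (f y / m1 x))%:E.
have mfm x : measurable_fun setT (fun y => f y / m1 x)%R.
  exact: measurable_funM.
have fm0 x y : (0 <= f y / m1 x)%R by rewrite divr_ge0.
have phi0 x y : 0 <= (kl_fun (f y / m1 x))%:E by rewrite lee_fin kl_fun_ge0.
have hE0 x : 0 <= hE x by exact: integral_ge0.
have mV : measurable_fun setT (fun x => (m1 x)^-1)%R.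
  under eq_fun do rewrite -powR_inv1//.
  exact: measurableT_comp (measurable_powR _) mm1.
have mhE : measurable_fun setT hE.
  apply: (measurable_fun_integral_sfinite_kernel
    (fun z : T * T => (kl_fun (f z.2 / m1 z.1))%:E) P).
  - by move=> z; exact: phi0.
  - apply/measurable_EFinP; apply: measurableT_comp measurable_kl_fun _.
    apply: measurable_funM; first exact: measurableT_comp mf measurable_snd.
    exact: measurableT_comp mV measurable_fst.
have QE x : good x -> relative_entropy (Q x) (transition P x) = hE x.
  by move=> gx; have := QP x; rewrite gx => /relative_entropy_density ->.
have Hmix : \int[pi]_y (kl_fun (f y))%:E =
    \int[mu]_x \int[transition P x]_y (kl_fun (f y))%:E.
  apply: (integral_kernel_mixture piE).
  - by apply/measurable_EFinP; exact: measurableT_comp measurable_kl_fun mf.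
  - by move=> y; rewrite lee_fin kl_fun_ge0.
have phim0 x : 0 <= (kl_fun (m1 x))%:E by rewrite lee_fin kl_fun_ge0.
have mphim : measurable_fun setT (fun x => (kl_fun (m1 x))%:E).
  by apply/measurable_EFinP; exact: measurableT_comp measurable_kl_fun mm1.
have mmhE : measurable_fun setT (fun x => hE x * (m1 x)%:E).
  exact: emeasurable_funM.
have mh0 x : 0 <= hE x * (m1 x)%:E by rewrite mule_ge0// lee_fin.
have intnu0 (k : T -> \bar R) : measurable_fun setT k ->
    (forall x, 0 <= k x) -> \int[nu0]_x k x = \int[mu]_x (k x * (m1 x)%:E).
  by move=> mk k0; exact: (integral_density (nu := nu0) mm1 nu0E).
pose E0 := \int[mu]_x (kl_fun (m1 x))%:E; pose E1 := \int[nu0]_x hE x.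
have E00 : 0 <= E0 by exact: integral_ge0.
have E10 : 0 <= E1 by exact: integral_ge0.
have E01 : E0 + E1 <= \int[pi]_y (kl_fun (f y))%:E.
  rewrite /E1 intnu0// -ge0_integralD// Hmix.
  apply: ae_ge0_le_integral => //.
  - by move=> x _; rewrite adde_ge0.
  - exact: emeasurable_funD.
  - by move=> x _; apply: integral_ge0 => y _; rewrite lee_fin kl_fun_ge0.
  - apply: measurable_integral_transition.
      by apply/measurable_EFinP; exact: measurableT_comp measurable_kl_fun mf.
    by move=> y; rewrite lee_fin kl_fun_ge0.
  - apply: filterS mfin => x mx _; rewrite addeC muleC.
    by apply: entropy_normalize.
have E0fin : E0 \is a fin_num.
  by rewrite ge0_fin_numE// (le_lt_trans _ Hfin)// (le_trans _ E01)// leeDl.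
have E1fin : E1 \is a fin_num.
  by rewrite ge0_fin_numE// (le_lt_trans _ Hfin)// (le_trans _ E01)// leeDr.
have hEfin : {ae nu0, forall x, hE x \is a fin_num}.
  have : nu0.-integrable setT hE.
    apply/integrableP; split=> //.
    by under eq_integral do rewrite gee0_abs//; rewrite -ge0_fin_numE.
  by move/(integrable_ae measurableT); apply: filterS => x /(_ I).
have ae_good : {ae nu0, forall x, good x}.
  exists (m1 @^-1` `]-oo, 0%R]); split.
  - by rewrite -[X in measurable X]setTI; exact: (mm1).
  - rewrite nu0E; last by rewrite -[X in measurable X]setTI; exact: (mm1).
    rewrite integral0_eq// => x /=; rewrite in_itv/= => mx.
    by congr EFin; apply/eqP; rewrite eq_le mx m10.
  - by move=> x /= /negP; rewrite -leNgt in_itv.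
exists nu0, Q, (fine \o hE), (fine E0), (fine E1); split.
- by rewrite fineK// (relative_entropy_density mm1 m10 nu0E).
- split; first exact: measurableT_comp.
  + by move=> x /=; rewrite fine_ge0.
  + rewrite fineK//; apply: ae_eq_integral => //.
    * by apply/measurable_EFinP; exact: measurableT_comp.
    * by apply: filterS hEfin => x /= hx _; rewrite fineK.
- split; [exact: fine_ge0|exact: fine_ge0|].
  by rewrite EFinD !fineK// -relative_entropy_density.
- apply: filterS2 ae_good hEfin => x gx hx.
  by rewrite QE// /= fineK.
- move=> k mk k0.
  have intQ x : \int[Q x]_y k y = if good x
      then (m1 x)^-1%:E * \int[transition P x]_y (k y * (f y)%:E)
      else \int[transition P x]_y k y.
    have := QP x; case: ifPn => [gx QxE|_ ->//].
    rewrite (integral_density (mfm x) QxE)//.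
    under eq_integral do rewrite mulrC EFinM muleCA.
    rewrite ge0_integralZl_EFin//.
    + by move=> y _; rewrite mule_ge0.
    + exact: emeasurable_funM.
    + by rewrite invr_ge0.
  have mkf : measurable_fun setT (fun y => k y * (f y)%:E).
    exact: emeasurable_funM.
  have kf0 y : 0 <= k y * (f y)%:E by rewrite mule_ge0.
  have mint := measurable_integral_transition P mkf kf0.
  have mQk : measurable_fun setT (fun x => \int[Q x]_y k y).
    under eq_fun do rewrite intQ.
    apply: measurable_fun_ifT.
    + exact: measurable_fun_ltr.
    + by apply: emeasurable_funM => //; exact/measurable_EFinP.
    + exact: measurable_integral_transition.
  split=> //.
  rewrite intnu0//; last by move=> x; exact: integral_ge0.
  rewrite (integral_density mf nuE)// (integral_kernel_mixture piE)//.
  apply: ae_eq_integral => //.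
  + by apply: emeasurable_funM.
  + apply: filterS mfin => x mx _; rewrite intQ.
    case: ifPn => [gx|].
      by rewrite muleAC -EFinM mulVf ?mul1e// gt_eqF.
    rewrite /good -leNgt => mx0.
    have m1x0 : m1 x = 0%R by apply/eqP; rewrite eq_le mx0 m10.
    rewrite m1x0 mule0; apply: (etrans (y := \int[transition P x]_y 0)).
      apply: ae_eq_integral => //.
      have : ae_eq (transition P x) setT (EFin \o f) (cst 0).
        apply/(ae_eq_integral_abs _ measurableT) => //.
        transitivity (m x); last by rewrite mx m1x0.
        by apply: eq_integral => y _; rewrite gee0_abs// lee_fin.
      by apply: filterS => y /(_ I) /= -> _; rewrite mule0.
    by rewrite integral0.
Qed.

End entropy_disintegration.

(** * Powers of the distance on a Polish space *)

Section power_sum.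
Context {R : realType}.
Variables (p : R) (p1 : 1 <= p).
Implicit Types a b : R.

(** With [l = a / (a + b)], the weights [l ^ (1 - p)] and [(1 - l) ^ (1 - p)]
    are the optimal ones in the convexity bound
    [(s + t) ^ p <= l ^ (1 - p) s ^ p + (1 - l) ^ (1 - p) t ^ p]: equality
    holds at [s = a], [t = b] ([split_weightE]). A pointwise inequality with
    these fixed weights can be integrated, which is how Minkowski's inequality
    and the triangle inequality of the transport cost are obtained. *)
Definition split_weight a b := (a / (a + b)) `^ (1 - p).

(** Convexity of [t ^ p] at the points [a / l] and [b / (1 - l)]. *)
Lemma powR_split_le alpha beta a b :
  0 < alpha -> 0 < beta -> 0 <= a -> 0 <= b ->
  (a + b) `^ p <=
  split_weight alpha beta * a `^ p + split_weight beta alpha * b `^ p.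
Proof.
move=> al0 be0 a0 b0; pose l := alpha / (alpha + beta).
have ab0 : 0 < alpha + beta by rewrite addr_gt0.
have l0 : 0 < l by rewrite divr_gt0.
have lE : beta / (beta + alpha) = 1 - l.
  by rewrite /l [beta + _]addrC; field; rewrite gt_eqF.
have l1 : 0 < 1 - l by rewrite -lE divr_gt0// addrC.
have key x y : 0 < x -> 0 <= y -> x `^ (1 - p) * y `^ p = x * (y / x) `^ p.
  move=> x0 y0; have xge0 := ltW x0; rewrite powRM ?invr_ge0//.
  rewrite -(powR_inv1 xge0) -powRrM mulN1r powRD; last by rewrite (gt_eqF x0) implybT.
  rewrite powRr1//; ring.
rewrite /split_weight lE -/l !key//.
have li : Itv.spec (@Itv.num_sem R) (Itv.Real `[0%Z, 1%Z]) l.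
  by rewrite /= /Itv.num_sem/= num_real/= in_itv/=; lra.
have := convex_powR p1 (Itv.mk li).
move=> /(_ (a / l) (b / (1 - l))); rewrite !inE/= !in_itv/= !andbT.
have -> : 0 <= a / l by apply: divr_ge0 => //; exact: ltW.
have -> : 0 <= b / (1 - l) by apply: divr_ge0 => //; exact: ltW.
move=> /(_ isT isT).
rewrite !convRE => h.
have e1 : l * (a / l) = a by field; rewrite gt_eqF.
have e2 : (1 - l) * (b / (1 - l)) = b by field; rewrite gt_eqF.
have {h} : (l * (a / l) + (1 - l) * (b / (1 - l))) `^ p <=
    l * (a / l) `^ p + (1 - l) * (b / (1 - l)) `^ p by exact: h.
by rewrite e1 e2.
Qed.

Lemma split_weight_ge0 a b : 0 <= split_weight a b.
Proof. exact: powR_ge0. Qed.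

Lemma split_weightE a b : 0 < a -> 0 < b ->
  split_weight a b * a `^ p + split_weight b a * b `^ p = (a + b) `^ p.
Proof.
move=> a0 b0; have ab0 : 0 < a + b by rewrite addr_gt0.
have key x y : 0 < x -> 0 < y ->
    split_weight x y * x `^ p = x * (x + y) `^ (p - 1).
  move=> x0 y0; have xge0 := ltW x0; have xy0 := ltW (addr_gt0 x0 y0).
  rewrite /split_weight powRM ?invr_ge0// -(powR_inv1 xy0) -powRrM mulN1r opprB.
  rewrite mulrAC -powRD; last by rewrite (gt_eqF x0) implybT.
  by rewrite subrK powRr1.
rewrite !key// [b + a]addrC -mulrDl mulr_powRB1 ?ltW//.
by rewrite (lt_le_trans _ p1).
Qed.

Lemma powRD_le a b : p <= 2 -> 0 <= a -> 0 <= b ->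
  (a + b) `^ p <= 2 * (a `^ p + b `^ p).
Proof.
move=> p2 a0 b0.
have := powR_split_le ltr01 ltr01 a0 b0; rewrite /split_weight.
suff : (1 / (1 + 1)) `^ (1 - p) <= 2 :> R.
  by have := powR_ge0 a p; have := powR_ge0 b p; nra.
rewrite div1r -powR_inv1// -powRrM mulN1r opprB.
apply: (@le_trans _ _ ((1 + 1) `^ 1)); last by rewrite powRr1//; lra.
by apply: ler_powR; lra.
Qed.

End power_sum.

Section polish.
Context {R : realType} d (T : polishMetricType R d).
Implicit Types (x y : T) (a : R).

Lemma open_measurable (A : set T) : open A -> measurable A.
Proof. by move=> oA; rewrite polish_borel; exact: sub_sigma_algebra. Qed.

Lemma measurable_sublevel_open (f : T -> R) :
  (forall a, open [set x | f x < a]) -> measurable_fun setT f.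
Proof.
move=> fo; apply: (measurability _ (RGenInftyO.measurableE R)) => //.
move=> _ [_ [a ->] <-]; rewrite setTI; apply: open_measurable.
have -> : f @^-1` `]-oo, a[ = [set x | f x < a].
  by apply/seteqP; split=> x /=; rewrite in_itv.
exact: fo.
Qed.

Lemma open_mdist_lt x a : open [set y | mdist x y < a].
Proof.
rewrite openE => y /= xya; have e0 : 0 < a - mdist x y by rewrite subr_gt0.
apply: filterS (nbhsx_ballx y _ e0) => z; rewrite ballEmdist/= => yz.
by rewrite (le_lt_trans (metric_triangle x y z))//; lra.
Qed.

Lemma measurable_mdist x : measurable_fun setT (mdist x).
Proof. by apply: measurable_sublevel_open => a; exact: open_mdist_lt. Qed.

Lemma dense_sequence : exists s : nat -> T,
  forall x a, 0 < a -> exists n, mdist x (s n) < a.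
Proof.
have [D cD dD] := @polish_separable R d T.
have Dx x a : 0 < a -> exists2 y, D y & mdist x y < a.
  move=> a0; have [] := dD [set y | mdist x y < a].
  - by exists x => /=; rewrite mdistxx.
  - exact: open_mdist_lt.
  - by move=> y [xy Dy]; exists y.
have [D0|[s]] := pfcard_geP cD.
  by have [y] := Dx point 1 ltr01; rewrite D0.
exists s => x a /(Dx x)[y /(@surj _ _ _ _ s)[n _ <-] xy]; by exists n.
Qed.

(** The product sigma-algebra is the Borel one thanks to separability:
    [d(x, y) < a] holds iff [d(s n, x) + d(s n, y) < a] for some point [s n]
    of a dense sequence. *)
Lemma measurable_mdist2 : measurable_fun setT (fun z : T * T => mdist z.1 z.2).
Proof.
have [s sP] := dense_sequence.
apply: (measurability _ (RGenInftyO.measurableE R)) => //.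
move=> _ [_ [a ->] <-]; rewrite setTI.
pose h n (z : T * T) := mdist (s n) z.1 + mdist (s n) z.2.
have mh n : measurable_fun setT (h n).
  apply: measurable_funD; apply: measurableT_comp => //;
    exact: measurable_mdist.
have -> : (fun z : T * T => mdist z.1 z.2) @^-1` `]-oo, a[ =
    \bigcup_n (h n @^-1` `]-oo, a[).
  apply/seteqP; split=> -[x y] /=.
    rewrite in_itv/= => xya.
    have /(sP x)[n xn] : 0 < (a - mdist x y) / 2 by rewrite divr_gt0 ?subr_gt0.
    exists n => //=; rewrite in_itv/= /h/=.
    have := metric_triangle (s n) x y; rewrite (metric_sym (s n) x); lra.
  move=> [n _] /=; rewrite !in_itv/= /h/= => na.
  by rewrite (le_lt_trans _ na)// (metric_sym (s n) x); exact: metric_triangle.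
by apply: bigcupT_measurable => n; rewrite -[X in measurable X]setTI; exact: mh.
Qed.

End polish.

(** * Couplings and weak duality *)

Section couplings.
Local Open Scope ereal_scope.
Context {R : realType} d (T : polishMetricType R d).
Implicit Types (mu nu : probability T R) (g : probability (T * T)%type R).

Lemma measurable_mdist2_powR (p : R) :
  measurable_fun setT (fun z : T * T => ((mdist z.1 z.2) `^ p)%:E).
Proof.
apply/measurable_EFinP/(measurableT_comp (measurable_powR p)).
exact: measurable_mdist2.
Qed.

Lemma measurable_mdist_powR (p : R) (x : T) :
  measurable_fun setT (fun y => ((mdist x y) `^ p)%:E).
Proof.
apply/measurable_EFinP/(measurableT_comp (measurable_powR p)).
exact: measurable_mdist.
Qed.

Lemma coupling_integral_fst mu nu g (h : T -> \bar R) : coupling mu nu g ->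
  measurable_fun setT h -> (forall x, 0 <= h x) ->
  \int[g]_z h z.1 = \int[mu]_x h x.
Proof.
move=> [g1 _] mh h0.
transitivity (\int[pushforward g (fst : T * T -> T)]_x h x).
  by rewrite ge0_integral_pushforward//; exact: measurable_fst.
apply: eq_measure_integral => E mE _; apply: etrans (g1 E mE).
by congr (g _); apply/seteqP; split=> -[x y]/=; [|case].
Qed.

Lemma coupling_integral_snd mu nu g (h : T -> \bar R) : coupling mu nu g ->
  measurable_fun setT h -> (forall x, 0 <= h x) ->
  \int[g]_z h z.2 = \int[nu]_x h x.
Proof.
move=> [_ g2] mh h0.
transitivity (\int[pushforward g (snd : T * T -> T)]_x h x).
  by rewrite ge0_integral_pushforward//; exact: measurable_snd.
apply: eq_measure_integral => E mE _; apply: etrans (g2 E mE).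
by congr (g _); apply/seteqP; split=> -[x y]/=; [|case].
Qed.

Variables (p : R) (p1 : (1 <= p)%R).

Let p_gt0 : (0 < p)%R. Proof. exact: lt_le_trans p1. Qed.

Lemma wasserstein_le_coupling mu nu g (w : R) : (0 <= w)%R ->
  coupling mu nu g -> \int[g]_z ((mdist z.1 z.2) `^ p)%:E <= (w `^ p)%:E ->
  wasserstein p mu nu <= w%:E.
Proof.
move=> w0 cg gw; apply: ereal_inf_le; exists
  ((\int[g]_z ((mdist z.1 z.2) `^ p)%:E) `^ p^-1); first by exists g.
have -> : w%:E = (w `^ p)%:E `^ p^-1.
  by rewrite poweR_EFin -powRrM mulfV ?gt_eqF// powRr1.
apply: gt0_ler_poweR => //; rewrite ?invr_ge0 ?ltW// in_itv/= leey andbT.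
  by apply: integral_ge0 => z _; rewrite lee_fin powR_ge0.
by rewrite lee_fin powR_ge0.
Qed.

(** Almost optimal couplings, stated on [p]-th powers. *)
Lemma wasserstein_coupling_lt mu nu (w c : R) : (0 <= w)%R ->
  wasserstein p mu nu <= w%:E -> (w `^ p < c)%R ->
  exists2 g, coupling mu nu g & \int[g]_z ((mdist z.1 z.2) `^ p)%:E <= c%:E.
Proof.
move=> w0 Ww wc; have c0 : (0 < c)%R by exact: le_lt_trans (powR_ge0 w p) wc.
have : wasserstein p mu nu < (c `^ p^-1)%:E.
  apply: (le_lt_trans Ww); rewrite lte_fin.
  have -> : w = ((w `^ p) `^ p^-1)%R.
    by rewrite -powRrM mulfV ?gt_eqF// powRr1.
  by apply: gt0_ltr_powR; rewrite ?invr_gt0// nnegrE ?powR_ge0// ltW.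
move=> /ereal_inf_lt[_ [g cg <-] gc]; exists g => //.
rewrite leNgt; apply/negP => cg'; move: gc; apply/negP; rewrite -leNgt.
rewrite -poweR_EFin; apply: gt0_ler_poweR; rewrite ?invr_ge0 ?ltW//;
  rewrite in_itv/= leey andbT ?lee_fin ?ltW//.
exact: lt_trans cg'.
Qed.

Lemma coupling_dual_le mu nu g (phi psi : T -> \bar R) (a c : R) :
  (0 <= a)%R -> (0 <= c)%R -> coupling mu nu g ->
  measurable_fun setT phi -> measurable_fun setT psi ->
  (forall x, 0 <= phi x) -> (forall x, 0 <= psi x) ->
  (forall x y, phi x + psi y <= (a * mdist x y `^ p + c)%:E) ->
  \int[mu]_x phi x + \int[nu]_x psi x <=
  a%:E * \int[g]_z ((mdist z.1 z.2) `^ p)%:E + c%:E.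
Proof.
move=> a0 c0 cg mphi mpsi phi0 psi0 le.
have m1 : measurable_fun setT (fun z : T * T => phi z.1).
  exact: measurableT_comp mphi measurable_fst.
have m2 : measurable_fun setT (fun z : T * T => psi z.2).
  exact: measurableT_comp mpsi measurable_snd.
have cost0 (z : T * T) : setT z -> 0 <= ((mdist z.1 z.2) `^ p)%:E.
  by move=> _; rewrite lee_fin powR_ge0.
have mcost := measurable_mdist2_powR p.
rewrite -(coupling_integral_fst cg)// -(coupling_integral_snd cg)//.
rewrite -ge0_integralD//.
rewrite -[X in _ <= _ + X](integral_probability_cst g).
rewrite -ge0_integralZl// -ge0_integralD//; last 2 first.
- by move=> z _; rewrite mule_ge0 ?cost0.
- exact: measurable_funeM.
apply: ge0_le_integral => //.
- by move=> z _; rewrite adde_ge0.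
- exact: emeasurable_funD.
- by apply: emeasurable_funD => //; exact: measurable_funeM.
Qed.

Lemma wasserstein_dual_le mu nu (phi psi : T -> \bar R) (a c w : R) :
  (0 <= a)%R -> (0 <= c)%R -> (0 <= w)%R ->
  measurable_fun setT phi -> measurable_fun setT psi ->
  (forall x, 0 <= phi x) -> (forall x, 0 <= psi x) ->
  (forall x y, phi x + psi y <= (a * mdist x y `^ p + c)%:E) ->
  wasserstein p mu nu <= w%:E ->
  \int[mu]_x phi x + \int[nu]_x psi x <= (a * w `^ p + c)%:E.
Proof.
move=> a0 c0 w0 mphi mpsi phi0 psi0 le Ww.
apply/lee_addgt0Pr => e e0.
have a1 : (0 < a + 1)%R by lra.
have [|g cg gle] := @wasserstein_coupling_lt mu nu w (w `^ p + e / (a + 1))%R w0 Ww.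
  by rewrite ltrDl divr_gt0.
apply: (le_trans (coupling_dual_le a0 c0 cg mphi mpsi phi0 psi0 le)).
apply: (@le_trans _ _ (a%:E * (w `^ p + e / (a + 1))%:E + c%:E)).
  by rewrite leeD2r// lee_wpmul2l.
rewrite -EFinM -!EFinD lee_fin mulrDr.
suff : (a * (e / (a + 1)) <= e)%R by lra.
by rewrite mulrA ler_pdivrMr//; nra.
Qed.

(** The factor [2] comes from [p <= 2] and the term [1] from using a coupling
    that is only almost optimal. *)
Lemma moment_le mu nu (x0 : T) (w : R) : (p <= 2)%R -> (0 <= w)%R ->
  wasserstein p mu nu <= w%:E ->
  \int[mu]_x ((mdist x0 x) `^ p)%:E <=
  2%:E * (\int[nu]_x ((mdist x0 x) `^ p)%:E + (w `^ p + 1)%:E).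
Proof.
move=> p2 w0 Ww.
have [|g cg gle] := @wasserstein_coupling_lt mu nu w (w `^ p + 1)%R w0 Ww.
  by rewrite ltrDl.
have mcost := measurable_mdist2_powR p.
have md := measurable_mdist_powR p x0.
have d0 x : 0 <= ((mdist x0 x) `^ p)%:E by rewrite lee_fin powR_ge0.
have cost0 (z : T * T) : setT z -> 0 <= ((mdist z.1 z.2) `^ p)%:E.
  by move=> _; rewrite lee_fin powR_ge0.
have m1 : measurable_fun setT (fun z : T * T => ((mdist x0 z.1) `^ p)%:E).
  exact: measurableT_comp md measurable_fst.
have m2 : measurable_fun setT (fun z : T * T => ((mdist x0 z.2) `^ p)%:E).
  exact: measurableT_comp md measurable_snd.
rewrite -(coupling_integral_fst cg)// -(coupling_integral_snd cg)//.
apply: (@le_trans _ _ (2%:E * (\int[g]_z ((mdist x0 z.2) `^ p)%:E +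
    \int[g]_z ((mdist z.1 z.2) `^ p)%:E))); last first.
  by rewrite lee_wpmul2l// leeD2l.
rewrite -ge0_integralD// -ge0_integralZl//; last 2 first.
- exact: emeasurable_funD.
- by move=> z _; rewrite adde_ge0// cost0.
apply: ge0_le_integral => //.
- by apply: measurable_funeM; exact: emeasurable_funD.
- move=> -[x y] _ /=; rewrite -EFinD -EFinM lee_fin.
  apply: le_trans (powRD_le p1 p2 (mdist_ge0 _ _) (mdist_ge0 _ _)).
  apply: ge0_ler_powR; rewrite ?nnegrE ?addr_ge0 ?mdist_ge0//.
    exact: ltW.
  by rewrite (metric_sym x y) metric_triangle.
Qed.
End couplings.

(** * Strong duality by discretization *)

Section product_probability.
Local Open Scope ereal_scope.
Context {R : realType} d1 d2 (T1 : measurableType d1) (T2 : measurableType d2).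
Variables (mu : probability T1 R) (nu : probability T2 R).

(** A copy of the product measure that can carry a probability structure. *)
Definition prod_probability_def : set (T1 * T2) -> \bar R := mu \x nu.

HB.instance Definition _ := Measure.on prod_probability_def.

Let prod_setT : prod_probability_def setT = 1.
Proof.
rewrite /prod_probability_def -setXTT product_measure1E//.
by rewrite -[RHS]mule1; congr mule; exact: probability_setT.
Qed.

HB.instance Definition _ := Measure_isProbability.Build _ _ _
  prod_probability_def prod_setT.

Definition prod_probability : probability (T1 * T2)%type R :=
  prod_probability_def.

Lemma integral_prod_probability (f : T1 * T2 -> \bar R) :
  measurable_fun setT f -> (forall z, 0 <= f z) ->
  \int[prod_probability]_z f z = \int[mu]_x \int[nu]_y f (x, y).
Proof. by move=> mf f0; rewrite -fubini_tonelli1. Qed.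

Lemma integral_prod_probability_sym (f : T1 * T2 -> \bar R) :
  measurable_fun setT f -> (forall z, 0 <= f z) ->
  \int[prod_probability]_z f z = \int[nu]_y \int[mu]_x f (x, y).
Proof. by move=> mf f0; rewrite -fubini_tonelli2. Qed.

End product_probability.

Section cells.
Local Open Scope ereal_scope.
Context {R : realType} d (T : measurableType d) (I : finType) (cell : T -> I).
Hypothesis mcell : forall i, measurable (cell @^-1` [set i]).

Lemma measurable_cell d' (U : measurableType d') (F : I -> U) :
  measurable_fun setT (fun x => F (cell x)).
Proof.
move=> _ B mB; rewrite setTI.
have -> : (fun x => F (cell x)) @^-1` B =
    \bigcup_(i in [set i | B (F i)]) (cell @^-1` [set i]).
  apply/seteqP; split=> [x /= Bx|x [i /= Bi ->]//].
  by exists (cell x).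
by apply: fin_bigcup_measurable => // i _; exact: mcell.
Qed.

Lemma measurable_cell2 d' (U : measurableType d') (F : I -> I -> U) :
  measurable_fun setT (fun z : T * T => F (cell z.1) (cell z.2)).
Proof.
move=> _ B mB; rewrite setTI.
have -> : (fun z : T * T => F (cell z.1) (cell z.2)) @^-1` B =
    \bigcup_(ij in [set ij | B (F ij.1 ij.2)])
      ((cell @^-1` [set ij.1]) `*` (cell @^-1` [set ij.2])).
  apply/seteqP; split=> [[x y] /= Bx|[x y] [[i j] /= Bi [/= -> ->]]//].
  by exists (cell x, cell y).
by apply: fin_bigcup_measurable => // ij _; exact: measurableX.
Qed.

Lemma integral_cell (mu : probability T R) (F : I -> R) :
  (forall i, 0 <= F i)%R -> \int[mu]_x (F (cell x))%:E =
  (\sum_i F i * fine (mu (cell @^-1` [set i])))%:E.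
Proof.
move=> F0.
transitivity (\int[mu]_x
    \sum_(i <- index_enum I) (F i * \1_(cell @^-1` [set i]) x)%:E).
  apply: eq_integral => x _; rewrite sumEFin; congr EFin.
  rewrite (bigD1 (cell x))//= indicE mem_set// mulr1 big1 ?addr0// => i ix.
  by rewrite indicE memNset ?mulr0//= => ixE; rewrite ixE eqxx in ix.
rewrite ge0_integral_sum//; last 2 first.
- by move=> i; apply/measurable_EFinP; apply: measurable_funM.
- by move=> i x _; rewrite lee_fin mulr_ge0.
rewrite -sumEFin; apply: eq_bigr => i _.
under eq_integral do rewrite EFinM.
rewrite ge0_integralZl_EFin//; last exact/measurable_EFinP.
rewrite integral_indic// setIT EFinM fineK//.
exact: fin_num_measure.
Qed.

Lemma sum_cell_probability (mu : probability T R) :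
  (\sum_i fine (mu (cell @^-1` [set i])) = 1)%R.
Proof.
apply: EFin_inj; have := @integral_cell mu (fun=> 1%R) (fun=> ler01).
under eq_bigr do rewrite mul1r.
by move=> <-; exact: integral_probability_cst.
Qed.

(** A plan [gam] between cells is spread over the space by the density
    [gam i j / (mu_i nu_j)] with respect to the product measure. On cells of
    measure zero the density is set to [1] instead of [0], so that its
    marginals are [1] everywhere and not only almost everywhere. *)
Lemma cell_coupling (mu nu : probability T R) (gam : I -> I -> R) :
  (forall i j, 0 <= gam i j)%R ->
  (forall i, \sum_j gam i j = fine (mu (cell @^-1` [set i])))%R ->
  (forall j, \sum_i gam i j = fine (nu (cell @^-1` [set j])))%R ->
  exists g : probability (T * T)%type R,
    [/\ forall E, measurable E -> g (E `*` setT) = mu E,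
        forall E, measurable E -> g (setT `*` E) = nu E &
        forall F : I -> I -> R, (forall i j, 0 <= F i j)%R ->
          \int[g]_z (F (cell z.1) (cell z.2))%:E =
          (\sum_i \sum_j gam i j * F i j)%:E].
Proof.
move=> gam0 gam1 gam2.
pose a i := fine (mu (cell @^-1` [set i])).
pose b j := fine (nu (cell @^-1` [set j])).
have a0 i : (0 <= a i)%R by rewrite fine_ge0.
have b0 i : (0 <= b i)%R by rewrite fine_ge0.
have gama i j : a i = 0%R -> gam i j = 0%R.
  move=> ai; apply/eqP; rewrite eq_le gam0 andbT -ai /a -gam1 (bigD1 j)//=.
  by rewrite lerDl sumr_ge0.
have gamb i j : b j = 0%R -> gam i j = 0%R.
  move=> bj; apply/eqP; rewrite eq_le gam0 andbT -bj /b -gam2 (bigD1 i)//=.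
  by rewrite lerDl sumr_ge0.
pose K i j := (if (a i == 0) || (b j == 0) then 1 else gam i j / (a i * b j))%R.
have K0 i j : (0 <= K i j)%R.
  by rewrite /K; case: ifP => // _; rewrite divr_ge0// mulr_ge0.
have KE i j : (a i * b j * K i j = gam i j)%R.
  rewrite /K; case: ifPn => [/orP[/eqP ai|/eqP bj]|]; last first.
  - by rewrite negb_or => /andP[? ?]; field; apply/andP.
  - by rewrite bj mulr0 mul0r gamb.
  - by rewrite ai !mul0r gama.
have K1 i : (\sum_j K i j * b j = 1)%R.
  have [ai|ai] := eqVneq (a i) 0%R.
    rewrite -[RHS](sum_cell_probability nu); apply: eq_bigr => j _.
    by rewrite /K ai eqxx mul1r.
  apply: (mulfI ai); rewrite mulr1 mulr_sumr -[RHS]gam1.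
  by apply: eq_bigr => j _; rewrite -KE; ring.
have K2 j : (\sum_i K i j * a i = 1)%R.
  have [bj|bj] := eqVneq (b j) 0%R.
    rewrite -[RHS](sum_cell_probability mu); apply: eq_bigr => i _.
    by rewrite /K bj eqxx orbT mul1r.
  apply: (mulfI bj); rewrite mulr1 mulr_sumr -[RHS]gam2.
  by apply: eq_bigr => i _; rewrite -KE; ring.
pose k (z : T * T) := K (cell z.1) (cell z.2).
have mk : measurable_fun setT k by exact: (measurable_cell2 K).
have k0 z : (0 <= k z)%R by exact: K0.
have intk1 x : \int[nu]_y (k (x, y))%:E = 1.
  by rewrite /k/= (@integral_cell _ (K (cell x)))// K1.
have intk2 y : \int[mu]_x (k (x, y))%:E = 1.
  by rewrite /k/= (@integral_cell _ (K ^~ (cell y)))// K2.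
have k1 : \int[prod_probability mu nu]_z (k z)%:E = 1.
  rewrite integral_prod_probability//; last exact/measurable_EFinP.
  under eq_integral do rewrite intk1.
  exact: integral_probability_cst.
have indicXT E x y : \1_(E `*` setT : set (T * T)) (x, y) = \1_E x :> R.
  by rewrite !indicE in_setX in_setT andbT.
have indicTX E x y : \1_(setT `*` E : set (T * T)) (x, y) = \1_E y :> R.
  by rewrite !indicE in_setX in_setT.
set g := density mk k0 k1.
have intg (h : T * T -> R) : measurable_fun setT h -> (forall z, 0 <= h z)%R ->
    \int[g]_z (h z)%:E = \int[prod_probability mu nu]_z (h z * k z)%:E.
  move=> mh h0.
  rewrite (@integral_density _ _ _ (prod_probability mu nu) k g)//.
  exact/measurable_EFinP.
have mhk (h : T * T -> R) : measurable_fun setT h ->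
    measurable_fun setT (fun z => (h z * k z)%:E).
  by move=> mh; apply/measurable_EFinP; exact: measurable_funM.
have hk0 (h : T * T -> R) : (forall z, 0 <= h z)%R ->
    forall z, 0 <= (h z * k z)%:E.
  by move=> h0 z; rewrite lee_fin mulr_ge0.
have mky x : measurable_fun setT (fun y => (k (x, y))%:E).
  exact/measurable_EFinP/(measurable_cell (K (cell x))).
have mkx y : measurable_fun setT (fun x => (k (x, y))%:E).
  exact/measurable_EFinP/(measurable_cell (K ^~ (cell y))).
exists g; split.
- move=> E mE; have mET : measurable (E `*` setT : set (T * T)).
    exact: measurableX.
  transitivity (\int[g]_z (\1_(E `*` setT : set (T * T)) z)%:E).
    by rewrite integral_indic// setIT.
  transitivity (\int[mu]_x (\1_E x)%:E); last by rewrite integral_indic// setIT.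
  rewrite intg// integral_prod_probability//; [|by apply: mhk|by apply: hk0].
  apply: eq_integral => x _.
  under eq_integral do rewrite indicXT EFinM.
  rewrite ge0_integralZl_EFin//; first by rewrite intk1 mule1.
  by move=> y _; rewrite lee_fin.
- move=> E mE; have mET : measurable (setT `*` E : set (T * T)).
    exact: measurableX.
  transitivity (\int[g]_z (\1_(setT `*` E : set (T * T)) z)%:E).
    by rewrite integral_indic// setIT.
  transitivity (\int[nu]_y (\1_E y)%:E); last by rewrite integral_indic// setIT.
  rewrite intg// integral_prod_probability_sym//; [|by apply: mhk|by apply: hk0].
  apply: eq_integral => y _.
  under eq_integral do rewrite indicTX EFinM.
  rewrite ge0_integralZl_EFin//; first by rewrite intk2 mule1.
  by move=> x _; rewrite lee_fin.
- move=> F F0; have mF := measurable_cell2 F.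
  rewrite intg// integral_prod_probability//; [|by apply: mhk|by apply: hk0].
  under eq_integral.
    move=> x _.
    rewrite /k/= (@integral_cell _ (fun j => F (cell x) j * K (cell x) j)%R).
      over.
    by move=> j; rewrite mulr_ge0.
  rewrite (@integral_cell _ (fun i => \sum_j F i j * K i j * b j)%R); last first.
    by move=> i; rewrite sumr_ge0// => j _; rewrite !mulr_ge0.
  congr EFin; apply: eq_bigr => i _; rewrite mulr_suml; apply: eq_bigr => j _.
  by rewrite -KE /a /b; ring.
Qed.

End cells.

Lemma vanishing_integral {R : realType} d (T : measurableType d)
    (m : {measure set T -> \bar R}) (h : T -> R) (Z : nat -> set T) (eta : R) :
  measurable_fun setT h -> (forall x, 0 <= h x) ->
  (\int[m]_x (h x)%:E < +oo)%E -> (forall n, measurable (Z n)) ->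
  (forall x, exists N, forall n, (N <= n)%N -> ~ Z n x) -> 0 < eta ->
  exists N, forall n, (N <= n)%N ->
    (\int[m]_x (h x * \1_(Z n) x)%:E <= eta%:E)%E.
Proof.
move=> mh h0 hfin mZ Zx eta0.
have ih : m.-integrable setT (EFin \o h).
  apply/integrableP; split; first exact/measurable_EFinP.
  by under eq_integral do rewrite /= ger0_norm//.
have [|||||_ _] := @dominated_convergence _ _ _ m setT measurableT
  (fun n x => (h x * \1_(Z n) x)%:E) (cst 0%E) (EFin \o h).
- by move=> n; apply/measurable_EFinP; exact: measurable_funM.
- by [].
- apply: aeW => x _; have [N NZ] := Zx x; apply: cvg_near_cst.
  by exists N => // n /= /NZ nZ; rewrite indicE memNset// mulr0.
- exact: ih.
- apply: aeW => x n _; rewrite /= lee_fin ger0_norm ?mulr_ge0//.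
  by rewrite ler_piMr// indicE; case: (_ \in _).
rewrite integral0 => u0.
have : \forall n \near \oo, (\int[m]_x (h x * \1_(Z n) x)%:E < eta%:E)%E.
  apply: (u0 [set y | (y < eta%:E)%E]); apply: open_nbhs_nbhs; split.
    exact: open_ereal_lt_ereal.
  by rewrite /= lte_fin.
by move=> [N _ NZ]; exists N => n /NZ/ltW.
Qed.

Lemma measurable_find d (T : measurableType d) (P : nat -> T -> bool)
    (s : seq nat) (k : nat) : (forall n, measurable [set x | P n x]) ->
  measurable [set x | find (fun n => P n x) s = k].
Proof.
move=> mP.
have mcst (Q : Prop) : measurable [set _ : T | Q].
  have [q|q] := pselect Q.
    by have -> : [set _ : T | Q] = setT by apply/seteqP; split.
  by have -> : [set _ : T | Q] = set0 by apply/seteqP; split.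
elim: s k => [|n s IH] k /=; first exact: mcst.
have -> : [set x | (if P n x then 0%N else (find (fun n => P n x) s).+1) = k] =
    ([set x | P n x] `&` [set _ | 0%N = k]) `|`
    (~` [set x | P n x] `&` [set x | (find (fun n => P n x) s).+1 = k]).
  apply/seteqP; split=> x /=.
    by case: ifP => Pn; [left|right; split=> //; apply/negP; rewrite Pn].
  by case: ifP => Pn [[? ?]|[? ?]].
apply: measurableU; apply: measurableI => //; first exact: measurableC.
case: k => [|k].
  have -> : [set x | (find (fun n => P n x) s).+1 = 0%N] = set0.
    by apply/seteqP; split.
  exact: measurable0.
have -> : [set x | (find (fun n => P n x) s).+1 = k.+1] =
    [set x | find (fun n => P n x) s = k].
  by apply/seteqP; split=> x /= => [[]|->].
exact: IH.
Qed.

Section strong_duality.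
Local Open Scope ereal_scope.
Context {R : realType} d (T : polishMetricType R d).
Variables (p : R) (p1 : (1 <= p)%R) (p2 : (p <= 2)%R).

Let p_gt0 : (0 < p)%R. Proof. exact: lt_le_trans p1. Qed.

(** The cells are the first [N] balls of radius [e / 2] around a dense
    sequence, made disjoint and cut by a ball [d(x0, x) < r], and the last cell
    is the remainder. The radius [r] is chosen first, so that the moments
    outside of the ball are small, and then [N], so that the part of the ball
    left uncovered has mass small compared with [r ^ p]. The function [q]
    controls the distances to points of the remainder: it is at least [r ^ p]
    there and at least [d(x0, y) ^ p] outside of the ball. *)
Lemma fine_partition (mu nu : probability T R) (x0 : T) (e eta : R) :
  \int[mu]_x ((mdist x0 x) `^ p)%:E < +oo ->
  \int[nu]_x ((mdist x0 x) `^ p)%:E < +oo ->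
  (0 < e)%R -> (0 < eta)%R ->
  exists N (cell : T -> 'I_N.+1) (q : T -> R),
    [/\ forall i, measurable (cell @^-1` [set i]),
        forall x y, cell x = cell y -> cell x != ord_max -> (mdist x y <= e)%R,
        forall x y, cell x = ord_max -> (mdist x0 y `^ p <= q x + q y)%R,
        measurable_fun setT q /\ (forall x, 0 <= q x)%R &
        \int[mu]_x (q x)%:E <= eta%:E /\ \int[nu]_x (q x)%:E <= eta%:E].
Proof.
move=> mufin nufin e0 eta0.
have [s sP] := dense_sequence T.
pose h x := (mdist x0 x `^ p)%R.
have mh : measurable_fun setT h by exact/measurable_EFinP/measurable_mdist_powR.
have h0 x : (0 <= h x)%R by exact: powR_ge0.
have eta20 : (0 < eta / 2)%R by rewrite divr_gt0.
have mball (x : T) (a : R) : measurable [set y | (mdist x y < a)%R].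
  by apply: open_measurable; exact: open_mdist_lt.
pose Z1 (n : nat) := ~` [set x | (mdist x0 x < n%:R)%R].
have mZ1 n : measurable (Z1 n) by apply: measurableC; exact: mball.
have vZ1 x : exists N, forall n, (N <= n)%N -> ~ Z1 n x.
  exists (Num.truncn (mdist x0 x)).+1 => n Nn; apply; rewrite /=.
  apply: (@lt_le_trans _ _ (Num.truncn (mdist x0 x)).+1%:R).
    by rewrite Num.Theory.truncnS_gt.
  by rewrite ler_nat.
have [N1 N1P] := vanishing_integral mh h0 mufin mZ1 vZ1 eta20.
have [N2 N2P] := vanishing_integral mh h0 nufin mZ1 vZ1 eta20.
pose r : R := (maxn N1 N2)%:R.
pose Z2 N := [set x | (mdist x0 x < r)%R] `&`
  (~` \bigcup_(n in [set n | (n < N)%N]) [set x | (mdist (s n) x < e / 2)%R]).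
have mZ2 n : measurable (Z2 n).
  apply: measurableI; first exact: mball.
  by apply: measurableC; apply: bigcup_measurable => k _; exact: mball.
have vZ2 x : exists N, forall n, (N <= n)%N -> ~ Z2 n x.
  have e20 : (0 < e / 2)%R by rewrite divr_gt0.
  have [N xN] := sP x _ e20.
  exists N.+1 => n Nn [_]; apply; exists N => //=.
  by rewrite metric_sym.
have mr : measurable_fun (setT : set T) (cst (r `^ p)%R) by [].
have r0 (x : T) : (0 <= cst (r `^ p) x)%R by exact: powR_ge0.
have rfin (m : probability T R) : \int[m]_x (r `^ p)%:E < +oo.
  by rewrite integral_probability_cst ltry.
have [M1 M1P] := vanishing_integral mr r0 (rfin mu) mZ2 vZ2 eta20.
have [M2 M2P] := vanishing_integral mr r0 (rfin nu) mZ2 vZ2 eta20.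
pose N := maxn M1 M2.
pose P n x := ((mdist x0 x < r) && (mdist (s n) x < e / 2))%R.
have mP n : measurable [set x | P n x].
  rewrite (_ : [set x | P n x] = [set x | (mdist x0 x < r)%R] `&`
    [set x | (mdist (s n) x < e / 2)%R]); first exact: measurableI.
  by apply/seteqP; split=> x /= => [/andP[]|[? ?]]//; apply/andP.
pose ind x := find (fun n => P n x) (iota 0 N).
have indN x : (ind x < N.+1)%N.
  by rewrite ltnS (leq_trans (find_size _ _))// size_iota.
pose cell x : 'I_N.+1 := Ordinal (indN x).
pose q x := (h x * \1_(Z1 (maxn N1 N2)) x + r `^ p * \1_(Z2 N) x)%R.
have mq1 : measurable_fun setT (fun x => h x * \1_(Z1 (maxn N1 N2)) x)%R.
  exact: measurable_funM.
have mq2 : measurable_fun setT (fun x : T => r `^ p * \1_(Z2 N) x)%R.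
  exact: measurable_funM.
have q10 x : (0 <= h x * \1_(Z1 (maxn N1 N2)) x)%R by rewrite mulr_ge0.
have q20 x : (0 <= r `^ p * \1_(Z2 N) x)%R by rewrite mulr_ge0// powR_ge0.
have q_far y : (r <= mdist x0 y)%R -> (mdist x0 y `^ p <= q y)%R.
  move=> ry; rewrite /q [in leRHS]indicE mem_set ?mulr1 ?lerDl//.
  by rewrite /Z1 /= -/r; apply/negP; rewrite -leNgt.
have q_rest x : cell x = ord_max -> (r `^ p <= q x)%R.
  move=> /(congr1 val)/= xN.
  have [xr|rx] := ltP (mdist x0 x) r; last first.
    apply: le_trans (q_far _ rx).
    apply: ge0_ler_powR; rewrite ?nnegrE ?ler0n ?mdist_ge0//; exact: ltW.
  rewrite /q addrC [in leRHS]indicE mem_set ?mulr1 ?lerDl//.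
  split=> // -[n /= nN sn].
  have : ~~ has (fun n => P n x) (iota 0 N).
    by rewrite has_find size_iota -leqNgt; apply/eq_leq/esym.
  move/hasPn/(_ n); rewrite mem_iota add0n nN => /(_ isT).
  by rewrite /P xr sn.
exists N, cell, q; split.
- move=> i; rewrite (_ : _ @^-1` _ =
    [set x | find (fun n => P n x) (iota 0 N) = i]).
    exact: measurable_find.
  apply/seteqP; split=> x /=; first by move=> <-.
  by move=> xi; apply: val_inj.
- have near x : cell x != ord_max -> (mdist (s (ind x)) x < e / 2)%R.
    move=> xN; have xN' : (ind x < N)%N.
      by rewrite ltn_neqAle -ltnS indN andbT; apply: contra xN => /eqP xN;
        apply/eqP/val_inj.
    have : has (fun n => P n x) (iota 0 N) by rewrite has_find size_iota.
    by move=> /(nth_find 0%N); rewrite nth_iota// add0n => /andP[].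
  move=> x y xy xN; have yN : cell y != ord_max by rewrite -xy.
  have near_x := near _ xN; have := near _ yN.
  rewrite (_ : ind y = ind x); last by move/(congr1 val): xy.
  move=> near_y; apply: le_trans (metric_triangle x (s (ind x)) y) _.
  by rewrite (metric_sym x) (splitr e) ltW// ltrD.
- move=> x y xN; have qx := q_rest x xN.
  have qy0 : (0 <= q y)%R by rewrite addr_ge0.
  have qx0 : (0 <= q x)%R by rewrite addr_ge0.
  have [yr|ry] := ltP (mdist x0 y) r; last by have := q_far _ ry; lra.
  have : (mdist x0 y `^ p <= r `^ p)%R; last by lra.
  apply: ge0_ler_powR; rewrite ?nnegrE ?mdist_ge0 ?ler0n//; exact: ltW.
- by split; [exact: measurable_funD|move=> x; rewrite addr_ge0].
- have intq (m : probability T R) : \int[m]_x (q x)%:E =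
      \int[m]_x (h x * \1_(Z1 (maxn N1 N2)) x)%:E +
      \int[m]_x (r `^ p * \1_(Z2 N) x)%:E.
    exact: integral_addr_EFin.
  rewrite !intq (_ : eta%:E = (eta / 2)%:E + (eta / 2)%:E).
    by split; apply: leeD; [apply: N1P|apply: M1P|apply: N2P|apply: M2P];
      rewrite ?leq_maxl ?leq_maxr.
  by rewrite -EFinD; congr EFin; lra.
Qed.

(** The finite problem has cost [c i j], the infimum of [d(x, y) ^ p] over the
    cells [i] and [j]: potentials for [c] are then cellwise constant potentials
    for [d ^ p], so the hypothesis bounds the finite problem by [C ^ p]. For
    the coupling spread from a finite plan, [d(x, y)] exceeds the cell distance
    by at most twice the diameter [e / 4] of a cell, and the remainder cell
    contributes at most [12 * eta]. *)
Lemma wasserstein_le_dual (mu nu : probability T R) (x0 : T) (C : R) :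
  \int[mu]_x ((mdist x0 x) `^ p)%:E < +oo ->
  \int[nu]_x ((mdist x0 x) `^ p)%:E < +oo ->
  (0 < C)%R ->
  (forall (f g : T -> R) (b c : R),
    measurable_fun setT f -> measurable_fun setT g ->
    (forall x, 0 <= f x <= b)%R -> (forall x, 0 <= g x <= b)%R -> (0 <= c)%R ->
    (forall x y, f x + g y <= mdist x y `^ p + c)%R ->
    \int[mu]_x (f x)%:E + \int[nu]_y (g y)%:E <= (C `^ p + c)%:E) ->
  wasserstein p mu nu <= C%:E.
Proof.
move=> mufin nufin C0 dual; apply/lee_addgt0Pr => e e0.
have e20 : (0 < e / 2)%R by rewrite divr_gt0.
have C0' := ltW C0.
pose eta := (((C + e) `^ p - (C + e / 2) `^ p) / 12)%R.
have eta0 : (0 < eta)%R.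
  rewrite divr_gt0// subr_gt0; apply: gt0_ltr_powR; rewrite ?nnegrE//; lra.
have e40 : (0 < e / 4)%R by rewrite divr_gt0.
have [N [cell [q [mcell near far [mq q0] [muq nuq]]]]] :=
  fine_partition mufin nufin e40 eta0.
pose a i := fine (mu (cell @^-1` [set i])).
pose b i := fine (nu (cell @^-1` [set i])).
pose D i j := [set t : R | exists x y, [/\ cell x = i, cell y = j &
                                            t = (mdist x y `^ p)%R]].
pose c i j := inf (D i j).
have D0 i j : lbound (D i j) 0%R.
  by move=> _ [x [y [_ _ ->]]]; exact: powR_ge0.
have c0 i j : (0 <= c i j)%R.
  have [D_eq0|/set0P D_neq0] := eqVneq (D i j) set0.
    by rewrite /c D_eq0 inf0.
  by apply: lb_le_inf.
have c_le x y : (c (cell x) (cell y) <= mdist x y `^ p)%R.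
  by apply: ge_inf; [exists 0%R; exact: D0|exists x, y].
have mcellF (F : 'I_N.+1 -> R) : measurable_fun setT (fun x => F (cell x)).
  exact: measurable_cell.
have [|||||gam [gam0 gam1 gam2 gamC]] :=
    @finite_transport_duality R _ _ a b c (C `^ p)%R.
- by move=> i; rewrite fine_ge0.
- by move=> i; rewrite fine_ge0.
- exact: sum_cell_probability.
- exact: sum_cell_probability.
- move=> u v uvc.
  (* an upper bound on all [|u i|] and [|v j|]: shifted by [s], the
     potentials are nonnegative *)
  pose s := (\sum_i `|u i| + \sum_i `|v i|)%R.
  have us i : (`|u i| <= s)%R.
    by rewrite /s (bigD1 i)//= -addrA lerDl addr_ge0 ?sumr_ge0.
  have vs i : (`|v i| <= s)%R.
    by rewrite /s addrC (bigD1 i)//= -addrA lerDl addr_ge0 ?sumr_ge0.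
  have us0 i : (0 <= u i + s <= s + s)%R.
    by have := us i; rewrite ler_norml; lra.
  have vs0 i : (0 <= v i + s <= s + s)%R.
    by have := vs i; rewrite ler_norml; lra.
  have s0 : (0 <= s + s)%R by have := us0 ord0; lra.
  have := dual (fun x => u (cell x) + s)%R (fun x => v (cell x) + s)%R
    (s + s)%R (s + s)%R (mcellF (fun i => u i + s)%R)
    (mcellF (fun i => v i + s)%R) (fun x => us0 (cell x))
    (fun x => vs0 (cell x)) s0.
  rewrite (@integral_cell _ _ _ _ _ mcell mu (fun i => u i + s)%R); last first.
    by move=> i; have := us0 i; lra.
  rewrite (@integral_cell _ _ _ _ _ mcell nu (fun i => v i + s)%R); last first.
    by move=> i; have := vs0 i; lra.
  have shift (w m : 'I_N.+1 -> R) : (\sum_i m i = 1 ->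
      \sum_i (w i + s) * m i = \sum_i w i * m i + s)%R.
    move=> m1; under eq_bigr do rewrite mulrDl.
    by rewrite big_split/= -mulr_sumr m1 mulr1.
  rewrite !shift; try exact: sum_cell_probability.
  rewrite -EFinD lee_fin => dualuv.
  suff : (forall x y, u (cell x) + s + (v (cell y) + s) <=
                      mdist x y `^ p + (s + s))%R by move/dualuv; lra.
  by move=> x y; have := uvc (cell x) (cell y); have := c_le x y; lra.
have [g [g1 g2 gF]] := cell_coupling mcell gam0 gam1 gam2.
have cg : coupling mu nu g by split.
apply: (wasserstein_le_coupling p1 _ cg); first by lra.
pose L := split_weight p C (e / 2).
pose B := (split_weight p (e / 2) C * (e / 2) `^ p)%R.
have L0 : (0 < L)%R by rewrite powR_gt0// divr_gt0//; lra.
have B0 : (0 <= B)%R by rewrite mulr_ge0 ?powR_ge0.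
have bound x y : (mdist x y `^ p <=
    L * c (cell x) (cell y) + B + 6 * q x + 6 * q y)%R.
  have qx := q0 x; have qy := q0 y; have cxy := c0 (cell x) (cell y).
  have farxy : cell x = ord_max \/ cell y = ord_max ->
      (mdist x y `^ p <= 6 * q x + 6 * q y)%R.
    move=> xyN.
    have dxy : (mdist x0 x `^ p + mdist x0 y `^ p <= 3 * q x + 3 * q y)%R.
      case: xyN => [xN|yN].
        by have := far x x xN; have := far x y xN; lra.
      by have := far y x yN; have := far y y yN; lra.
    have : (mdist x y `^ p <= (mdist x0 x + mdist x0 y) `^ p)%R.
      apply: ge0_ler_powR; rewrite ?nnegrE ?addr_ge0 ?mdist_ge0//.
        exact: ltW.
      by rewrite (metric_sym x0 x) metric_triangle.
    have := powRD_le p1 p2 (mdist_ge0 x0 x) (mdist_ge0 x0 y).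
    by lra.
  have Lc : (0 <= L * c (cell x) (cell y))%R by rewrite mulr_ge0// ltW.
  have [xN|xN] := eqVneq (cell x) ord_max.
    by have := farxy (or_introl xN); lra.
  have [yN|yN] := eqVneq (cell y) ord_max.
    by have := farxy (or_intror yN); lra.
  suff : ((mdist x y `^ p - B) / L <= c (cell x) (cell y))%R.
    by rewrite ler_pdivrMr//; lra.
  apply: lb_le_inf; first by exists (mdist x y `^ p)%R, x, y.
  move=> _ [x' [y' [xx' yy' ->]]]; rewrite ler_pdivrMr// lerBlDr mulrC.
  apply: (@le_trans _ _ ((mdist x' y' + e / 2) `^ p)%R); last first.
    by apply: powR_split_le => //; [exact: mdist_ge0|exact: ltW].
  apply: ge0_ler_powR; rewrite ?nnegrE ?addr_ge0 ?mdist_ge0//; try exact: ltW.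
  have := near x x' (esym xx') xN; have := near y y' (esym yy') yN.
  have := metric_triangle x x' y; have := metric_triangle x' y' y.
  by rewrite (metric_sym y' y); lra.
have mc : measurable_fun setT (fun z : T * T => (c (cell z.1) (cell z.2))%:E).
  exact: (measurable_cell2 mcell (fun i j => (c i j)%:E)).
have mqE : measurable_fun setT (EFin \o q) by exact/measurable_EFinP.
have m1 : measurable_fun setT (fun z : T * T => (q z.1)%:E).
  exact: measurableT_comp mqE measurable_fst.
have m2 : measurable_fun setT (fun z : T * T => (q z.2)%:E).
  exact: measurableT_comp mqE measurable_snd.
have q0E x : 0 <= (q x)%:E by rewrite lee_fin.
apply: (@le_trans _ _ (\int[g]_z (L%:E * (c (cell z.1) (cell z.2))%:E + B%:E +
    6%:E * (q z.1)%:E + 6%:E * (q z.2)%:E))).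
  apply: ge0_le_integral => //.
  - by move=> z _; rewrite lee_fin powR_ge0.
  - exact: measurable_mdist2_powR.
  - by repeat (apply: emeasurable_funD => // || apply: measurable_funeM => //).
  - by move=> z _; rewrite -!EFinM -!EFinD lee_fin; exact: bound.
have mLc : measurable_fun setT
    (fun z : T * T => L%:E * (c (cell z.1) (cell z.2))%:E).
  exact: measurable_funeM.
have m41 : measurable_fun setT (fun z : T * T => 6%:E * (q z.1)%:E).
  exact: measurable_funeM.
have m42 : measurable_fun setT (fun z : T * T => 6%:E * (q z.2)%:E).
  exact: measurable_funeM.
have Lc0 (z : T * T) : setT z -> 0 <= L%:E * (c (cell z.1) (cell z.2))%:E.
  by move=> _; rewrite mule_ge0// lee_fin// ltW.
have B0E (z : T * T) : setT z -> 0 <= B%:E by rewrite lee_fin.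
have q1 (z : T * T) : setT z -> 0 <= 6%:E * (q z.1)%:E.
  by move=> _; rewrite mule_ge0.
have q2 (z : T * T) : setT z -> 0 <= 6%:E * (q z.2)%:E.
  by move=> _; rewrite mule_ge0.
have mLB : measurable_fun setT
    (fun z : T * T => L%:E * (c (cell z.1) (cell z.2))%:E + B%:E).
  exact: emeasurable_funD.
rewrite ge0_integralD//; last 2 first.
- by move=> z _; rewrite !adde_ge0 ?Lc0 ?(B0E z) ?q1.
- exact: emeasurable_funD.
rewrite ge0_integralD//; last by move=> z _; rewrite adde_ge0 ?Lc0 ?(B0E z).
rewrite ge0_integralD// ge0_integralZl_EFin//; last 2 first.
- by move=> z _; rewrite lee_fin.
- exact: ltW.
rewrite gF// ge0_integralZl_EFin// ge0_integralZl_EFin//.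
rewrite (@coupling_integral_fst _ _ _ _ _ _ (EFin \o q) cg)//.
rewrite (@coupling_integral_snd _ _ _ _ _ _ (EFin \o q) cg)//.
rewrite integral_probability_cst.
apply: (@le_trans _ _ (L%:E * (C `^ p)%:E + B%:E + 6%:E * eta%:E + 6%:E * eta%:E)).
  apply: leeD; [apply: leeD; [apply: leeD => //|]|];
    by apply: lee_wpmul2l => //; rewrite lee_fin// ltW.
rewrite -!EFinM -!EFinD lee_fin /B /L split_weightE// /eta; lra.
Qed.

End strong_duality.

(** * Integral inequalities and inf-convolution *)

Section integral_inequalities.
Local Open Scope ereal_scope.
Context {R : realType} d (T : measurableType d) (mu : probability T R).
Variables (p : R) (p1 : (1 <= p)%R).

Let measurable_powR_comp (f : T -> R) : measurable_fun setT f ->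
  measurable_fun setT (fun x => ((f x) `^ p)%:E).
Proof.
by move=> mf; apply/measurable_EFinP; exact: measurableT_comp (measurable_powR p) mf.
Qed.

Lemma minkowski_le (f g : T -> R) (a b : R) :
  measurable_fun setT f -> measurable_fun setT g ->
  (forall x, 0 <= f x)%R -> (forall x, 0 <= g x)%R -> (0 < a)%R -> (0 < b)%R ->
  \int[mu]_x (f x `^ p)%:E <= (a `^ p)%:E ->
  \int[mu]_x (g x `^ p)%:E <= (b `^ p)%:E ->
  \int[mu]_x ((f x + g x) `^ p)%:E <= ((a + b) `^ p)%:E.
Proof.
move=> mf mg f0 g0 a0 b0 fa gb.
have mfp := measurable_powR_comp mf; have mgp := measurable_powR_comp mg.
have pow0 (h : T -> R) x : 0 <= ((h x) `^ p)%:E by rewrite lee_fin powR_ge0.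
rewrite -(split_weightE p1 a0 b0).
apply: (@le_trans _ _ (\int[mu]_x ((split_weight p a b)%:E * (f x `^ p)%:E +
    (split_weight p b a)%:E * (g x `^ p)%:E))).
  apply: ge0_le_integral => //.
  - by move=> x _; rewrite lee_fin powR_ge0.
  - by apply: measurable_powR_comp; exact: measurable_funD.
  - by apply: emeasurable_funD; exact: measurable_funeM.
  - move=> x _; rewrite -!EFinM -EFinD lee_fin.
    exact: powR_split_le.
rewrite ge0_integralD//; last 4 first.
- by move=> x _; rewrite mule_ge0// lee_fin split_weight_ge0.
- exact: measurable_funeM.
- by move=> x _; rewrite mule_ge0// lee_fin split_weight_ge0.
- exact: measurable_funeM.
rewrite !ge0_integralZl_EFin// ?split_weight_ge0//.
rewrite EFinD !EFinM; apply: leeD; apply: lee_wpmul2l => //;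
  by rewrite lee_fin split_weight_ge0.
Qed.

(** Young's inequality [s ^ t <= t * s + (1 - t)] for [t = p / 2 <= 1], applied
    to [s = g x / a ^ 2], is the tangent line whose integral is the bound. *)
Lemma jensen_sqrt_le (g : T -> R) (a : R) : (p <= 2)%R ->
  measurable_fun setT g -> (forall x, 0 <= g x)%R -> (0 < a)%R ->
  \int[mu]_x (g x)%:E <= (a ^+ 2)%:E ->
  \int[mu]_x (Num.sqrt (g x) `^ p)%:E <= (a `^ p)%:E.
Proof.
move=> p2 mg g0 a0 ga.
pose t := (p / 2)%R.
have young x : (Num.sqrt (g x) `^ p <= a `^ p * (t / a ^+ 2) * g x + a `^ p * (1 - t))%R.
  have a20 : (0 < a ^+ 2)%R by rewrite exprn_gt0.
  have -> : (Num.sqrt (g x) `^ p = a `^ p * (g x / a ^+ 2) `^ t)%R.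
    rewrite powRM ?invr_ge0 ?(ltW a20)// -(@powR12_sqrt _ (g x))// -powRrM.
    rewrite [(2^-1 * p)%R]mulrC -/t -powR_mulrn ?(ltW a0)//.
    rewrite -powR_inv1 ?powR_ge0// -!powRrM mulN1r mulrN (_ : (2 * t = p)%R).
      by rewrite powRN mulrCA divff ?mulr1// gt_eqF// powR_gt0.
    by rewrite /t; field.
  rewrite -mulrA -mulrDr ler_pM2l ?powR_gt0//.
  have s0 : (0 <= g x / a ^+ 2)%R by rewrite divr_ge0// ltW.
  have -> : (t / a ^+ 2 * g x = t * (g x / a ^+ 2))%R by ring.
  move: (g x / a ^+ 2)%R s0 => s s0.
  have [pE|pN2] := eqVneq p 2%R.
    by rewrite /t pE divff// powRr1//; lra.
  have p20 : (p < 2)%R by rewrite lt_neqAle pN2.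
  have t0 : (0 < t)%R by rewrite divr_gt0// (lt_le_trans _ p1).
  have t1 : (0 < 1 - t)%R by rewrite /t; lra.
  have := @conjugate_powR R (s `^ t)%R 1%R t^-1%R (1 - t)^-1%R (powR_ge0 _ _) ler01.
  rewrite !invr_gt0 !invrK => /(_ t0 t1); rewrite addrC subrK => /(_ erefl).
  by rewrite mulr1 -powRrM divff ?gt_eqF// powRr1// powR1; lra.
have c0 : (0 <= a `^ p * (t / a ^+ 2))%R.
  rewrite mulr_ge0 ?powR_ge0// divr_ge0 ?exprn_ge0 ?(ltW a0)// /t.
  by rewrite divr_ge0// (le_trans ler01 p1).
have c1 : (0 <= a `^ p * (1 - t))%R by rewrite mulr_ge0 ?powR_ge0// /t; lra.
apply: (@le_trans _ _ (\int[mu]_x ((a `^ p * (t / a ^+ 2))%:E * (g x)%:E +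
    (a `^ p * (1 - t))%:E))).
  apply: ge0_le_integral => //.
  - apply: measurable_powR_comp.
    under eq_fun do rewrite -powR12_sqrt//.
    exact: measurableT_comp (measurable_powR _) mg.
  - apply: emeasurable_funD => //; apply: measurable_funeM.
    exact/measurable_EFinP.
  - by move=> x _; rewrite -EFinM -EFinD lee_fin.
rewrite ge0_integralD//; last 2 first.
- by move=> x _; rewrite mule_ge0// lee_fin.
- by apply: measurable_funeM; exact/measurable_EFinP.
rewrite ge0_integralZl_EFin//; last 2 first.
- by move=> x _; rewrite lee_fin.
- exact/measurable_EFinP.
rewrite integral_probability_cst.
apply: (@le_trans _ _ ((a `^ p * (t / a ^+ 2))%:E * (a ^+ 2)%:E +
    (a `^ p * (1 - t))%:E)).
  by rewrite leeD2r// lee_wpmul2l.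
rewrite -EFinM -EFinD lee_fin le_eqVlt; apply/orP; left; apply/eqP.
by field; rewrite gt_eqF.
Qed.

End integral_inequalities.

Section inf_convolution.
Context {R : realType} d (T : polishMetricType R d).
Variables (p : R) (p1 : 1 <= p).

(** [chi y] is the infimum over [x] of [C1 * d(x, y) ^ p - f x]. Being an
    infimum of continuous functions it has open sublevel sets, hence is
    measurable although the infimum is uncountable. The last property says
    that it is the largest function satisfying the preceding one. *)
Lemma inf_convolution (f : T -> R) (b C1 : R) : 0 < C1 ->
  (forall x, 0 <= f x <= b) ->
  exists chi : T -> R,
    [/\ measurable_fun setT chi, forall y, - b <= chi y <= 0,
        forall x y, f x + chi y <= C1 * mdist x y `^ p &
        forall y t, (forall x, t <= C1 * mdist x y `^ p - f x) -> t <= chi y].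
Proof.
move=> C10 fb; have p0 : 0 < p by exact: lt_le_trans p1.
pose D y := range (fun x => C1 * mdist x y `^ p - f x).
have Db y : lbound (D y) (- b).
  move=> _ [x _ <-]; have /andP[_ fxb] := fb x.
  have : 0 <= C1 * mdist x y `^ p by rewrite mulr_ge0 ?powR_ge0// ltW.
  by lra.
have D0 y : D y !=set0 by exists (C1 * mdist y y `^ p - f y), y.
have chi_le x y : inf (D y) <= C1 * mdist x y `^ p - f x.
  by apply: ge_inf; [exists (- b); exact: Db|exists x].
exists (fun y => inf (D y)); split.
- apply: measurable_sublevel_open => a; rewrite openE => y /= ya.
  have [_ [x _ <-] xa] := inf_lt (D0 y) ya.
  pose t := (a + f x) / C1.
  have ltt z : (C1 * mdist x z `^ p - f x < a) = (mdist x z `^ p < t).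
    by rewrite /t ltrBlDr ltr_pdivlMr// mulrC.
  have t0 : 0 <= t by rewrite ltW// (le_lt_trans (powR_ge0 (mdist x y) p))// -ltt.
  have tE : (t `^ p^-1) `^ p = t by rewrite -powRrM mulVf ?gt_eqF// powRr1.
  have : open_nbhs y [set z | mdist x z < t `^ p^-1].
    split; first exact: open_mdist_lt.
    rewrite /= ltNge; apply/negP => le; move: xa; apply/negP.
    rewrite ltt -leNgt -tE; apply: ge0_ler_powR => //; rewrite ?nnegrE ?powR_ge0//.
      exact: ltW.
    exact: mdist_ge0.
  move/open_nbhs_nbhs; apply: filterS => z /= zt.
  rewrite /interior/= (le_lt_trans (chi_le x z))// ltt -tE.
  by apply: gt0_ltr_powR => //; rewrite nnegrE ?powR_ge0// mdist_ge0.
- move=> y; apply/andP; split; first by apply: lb_le_inf; [exact: D0|exact: Db].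
  have := chi_le y y; rewrite mdistxx powR0 ?gt_eqF// mulr0.
  by have /andP[] := fb y; lra.
- by move=> x y; have := chi_le x y; lra.
- by move=> y t ty; apply: lb_le_inf => // _ [x _ <-].
Qed.

End inf_convolution.

(** * Transport through a Markov kernel *)

Section markov_transport.
Local Open Scope ereal_scope.
Context {R : realType} d (T : polishMetricType R d).
Variables (p : R) (p1 : (1 <= p)%R) (p2 : (p <= 2)%R).

Let p_ge0 : (0 <= p)%R. Proof. exact: le_trans p1. Qed.

Lemma mdist_powR_le (x y z : T) :
  (mdist x z `^ p <= 2 * (mdist x y `^ p + mdist y z `^ p))%R.
Proof.
apply: le_trans (powRD_le p1 p2 (mdist_ge0 _ _) (mdist_ge0 _ _)).
by apply: ge0_ler_powR; rewrite ?nnegrE ?addr_ge0 ?mdist_ge0// metric_triangle.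
Qed.

Let dp0 (x y : T) : 0 <= ((mdist x y) `^ p)%:E.
Proof. by rewrite lee_fin powR_ge0. Qed.

Let mdp (x : T) := measurable_mdist_powR p x.

Lemma finite_moment_at (mu : probability T R) (x : T) :
  finite_moment p mu -> \int[mu]_y ((mdist x y) `^ p)%:E < +oo.
Proof.
move=> [x0 mufin].
apply: (@le_lt_trans _ _ (2%:E * (\int[mu]_y ((mdist x x0) `^ p)%:E +
    \int[mu]_y ((mdist x0 y) `^ p)%:E))); last first.
  by rewrite integral_probability_cst lte_mul_pinfty// lte_add_pinfty// ltry.
rewrite -ge0_integralD// -ge0_integralZl_EFin//; last 2 first.
- by move=> y _; rewrite adde_ge0.
- exact: emeasurable_funD.
apply: ge0_le_integral => //.
- by apply: measurable_funeM; exact: emeasurable_funD.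
- by move=> y _; rewrite -EFinD -EFinM lee_fin mdist_powR_le.
Qed.

Variables (P : R.-pker T ~> T) (K M : R).
Hypotheses (K01 : (0 <= K <= 1)%R) (M0 : (0 <= M)%R).
Hypothesis P_lip : forall x y : T,
  wasserstein p (transition P x) (transition P y) <= (K * mdist x y + M)%:E.

Let K0 : (0 <= K)%R. Proof. by case/andP: K01. Qed.

Let KM0 (x y : T) : (0 <= K * mdist x y + M)%R.
Proof. by rewrite addr_ge0// mulr_ge0// mdist_ge0. Qed.

Lemma kernel_moment (mu : probability T R) (x0 : T) :
  finite_moment p (transition P x0) ->
  \int[mu]_x ((mdist x0 x) `^ p)%:E < +oo ->
  \int[mu]_x \int[transition P x]_y ((mdist x0 y) `^ p)%:E < +oo.
Proof.
move=> /(finite_moment_at x0) Pfin mufin.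
pose c := \int[transition P x0]_y ((mdist x0 y) `^ p)%:E.
have c0 : 0 <= c by exact: integral_ge0.
have cE : c = (fine c)%:E by rewrite fineK// ge0_fin_numE.
pose C := (2 * (fine c + (2 * M `^ p + 1)))%R.
have C0 : (0 <= C)%R.
  by rewrite mulr_ge0// addr_ge0 ?fine_ge0// addr_ge0// mulr_ge0// powR_ge0.
apply: (@le_lt_trans _ _ (\int[mu]_x (4%:E * ((mdist x0 x) `^ p)%:E + C%:E))).
  apply: ge0_le_integral => //.
  - by move=> x _; apply: integral_ge0.
  - exact: measurable_integral_transition.
  - by apply: emeasurable_funD => //; exact: measurable_funeM.
  - move=> x _; apply: (le_trans (moment_le p1 x0 p2 (KM0 x x0) (P_lip x x0))).
    rewrite -/c cE -!EFinD -EFinM lee_fin.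
    have : ((K * mdist x x0 + M) `^ p <= 2 * (mdist x0 x `^ p + M `^ p))%R.
      apply: le_trans (powRD_le p1 p2 (mdist_ge0 _ _) M0).
      apply: ge0_ler_powR; rewrite ?nnegrE ?KM0 ?addr_ge0 ?mdist_ge0//.
      rewrite lerD2r (metric_sym x) ler_piMl ?mdist_ge0//.
      by case/andP: K01.
    by rewrite /C; lra.
rewrite ge0_integralD//; last 2 first.
- by move=> x _; rewrite mule_ge0.
- exact: measurable_funeM.
rewrite ge0_integralZl_EFin// integral_probability_cst.
by rewrite lte_add_pinfty ?ltry// lte_mul_pinfty.
Qed.

(** The two legs on the dual side. For admissible [f] and [h], the potential
    [chi] of [inf_convolution] splits the constraint in two: [f] and [chi] for
    the cost [C1 * d ^ p] between [Q x] and [delta_x P], integrated over [nu0],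
    and [- chi] and [h] for the cost [C2 * d ^ p] between [delta_x P] and
    [delta_y P], integrated over the coupling [g] of [nu0] and [mu0]. Both
    bounds contain the integral of [chi] against [nu0 P], which cancels, and
    the weights are chosen such that
    [C1 * U ^ p + C2 * V ^ p = (U + V) ^ p]. *)
Lemma wasserstein_mixture_le (mu0 nu0 pi nu : probability T R)
    (Q : T -> probability T R) (g : probability (T * T)%type R)
    (w : T -> R) (x0 : T) (U V : R) :
  (forall E, measurable E -> pi E = \int[mu0]_x P x E) ->
  (forall k : T -> \bar R, measurable_fun setT k -> (forall x, 0 <= k x) ->
     measurable_fun setT (fun x => \int[Q x]_y k y) /\
     \int[nu]_y k y = \int[nu0]_x \int[Q x]_y k y) ->
  coupling nu0 mu0 g ->
  measurable_fun setT w -> (forall x, 0 <= w x)%R ->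
  {ae nu0, forall x, wasserstein p (Q x) (transition P x) <= (w x)%:E} ->
  (0 < U)%R -> (0 < V)%R ->
  \int[nu0]_x ((w x) `^ p)%:E <= (U `^ p)%:E ->
  \int[g]_z ((K * mdist z.1 z.2 + M) `^ p)%:E <= (V `^ p)%:E ->
  \int[nu]_x ((mdist x0 x) `^ p)%:E < +oo ->
  \int[pi]_x ((mdist x0 x) `^ p)%:E < +oo ->
  wasserstein p nu pi <= (U + V)%:E.
Proof.
move=> piE nuE cg mw w0 Qw U0 V0 wU gV nufin pifin.
have UV0 : (0 < U + V)%R by rewrite addr_gt0.
apply: (wasserstein_le_dual p1 p2 nufin pifin UV0) => f h b c mf mh fb hb c0 fh.
pose C1 := split_weight p U V; pose C2 := split_weight p V U.
have C10 : (0 < C1)%R by rewrite powR_gt0// divr_gt0.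
have C20 : (0 <= C2)%R by exact: split_weight_ge0.
have [chi [mchi chib chi1 chi2]] := inf_convolution p1 C10 fb.
have b0 : (0 <= b)%R by have /andP[] := fb point; exact: le_trans.
have chi3 y z : (- chi y + h z <= C2 * mdist y z `^ p + c)%R.
  suff : (h z - C2 * mdist y z `^ p - c <= chi y)%R by lra.
  apply: chi2 => x.
  have : (mdist x z `^ p <= C1 * mdist x y `^ p + C2 * mdist y z `^ p)%R.
    apply: le_trans (powR_split_le p1 U0 V0 (mdist_ge0 _ _) (mdist_ge0 _ _)).
    by apply: ge0_ler_powR; rewrite ?nnegrE ?addr_ge0 ?mdist_ge0// metric_triangle.
  by have := fh x z; lra.
(* [chi + b] and [- chi] are nonnegative; their sum is the constant [b] *)
pose chip x := (chi x + b)%R; pose chin x := (- chi x)%R.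
have chip0 x : (0 <= chip x)%R by rewrite /chip; have := chib x; lra.
have chin0 x : (0 <= chin x)%R by rewrite /chin; have := chib x; lra.
have mchip : measurable_fun setT (EFin \o chip).
  by apply/measurable_EFinP; exact: measurable_funD.
have mchin : measurable_fun setT (EFin \o chin).
  by apply/measurable_EFinP; exact: measurable_funN.
have mfE : measurable_fun setT (EFin \o f) by exact/measurable_EFinP.
have mhE : measurable_fun setT (EFin \o h) by exact/measurable_EFinP.
have f0 x : 0 <= (f x)%:E by rewrite lee_fin; case/andP: (fb x).
have h0 x : 0 <= (h x)%:E by rewrite lee_fin; case/andP: (hb x).
have chip0E x : 0 <= (chip x)%:E by rewrite lee_fin.
have chin0E x : 0 <= (chin x)%:E by rewrite lee_fin.
have mwp : measurable_fun setT (fun x => ((w x) `^ p)%:E).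
  by apply/measurable_EFinP; exact: measurableT_comp (measurable_powR _) mw.
have wp0 x : 0 <= ((w x) `^ p)%:E by rewrite lee_fin powR_ge0.
have [mQf nuf] := nuE _ mfE f0.
have mPp := measurable_integral_transition P mchip chip0E.
have mPn := measurable_integral_transition P mchin chin0E.
have mPh := measurable_integral_transition P mhE h0.
have ge0_int (m : probability T R) (k : T -> R) : (forall x, 0 <= (k x)%:E) ->
    0 <= \int[m]_x (k x)%:E by move=> k0; exact: integral_ge0.
pose X := \int[nu]_x (f x)%:E; pose Y := \int[pi]_y (h y)%:E.
pose A := \int[nu0]_x \int[transition P x]_y (chip y)%:E.
pose D := \int[nu0]_x \int[transition P x]_y (chin y)%:E.
have XA : X + A <= (C1 * U `^ p + b)%:E.
  rewrite /X nuf -ge0_integralD//; last 2 first.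
  - by move=> x _; exact: ge0_int.
  - by move=> x _; exact: ge0_int.
  apply: (@le_trans _ _ (\int[nu0]_x (C1%:E * ((w x) `^ p)%:E + b%:E))).
    apply: ae_ge0_le_integral => //.
    - by move=> x _; rewrite adde_ge0// ge0_int.
    - exact: emeasurable_funD.
    - move=> x _; rewrite -EFinM -EFinD lee_fin addr_ge0//.
      by rewrite mulr_ge0 ?powR_ge0// ltW.
    - by apply: emeasurable_funD => //; exact: measurable_funeM.
    - apply: filterS Qw => x Qwx _; rewrite -EFinM -EFinD.
      apply: (wasserstein_dual_le p1 (ltW C10) b0 (w0 x)) Qwx => // y z.
      by rewrite -EFinD lee_fin /chip; have := chi1 y z; lra.
  rewrite ge0_integralD//; last 2 first.
  - by move=> x _; rewrite mule_ge0// ltW.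
  - exact: measurable_funeM.
  rewrite ge0_integralZl_EFin// ?(ltW C10)// integral_probability_cst.
  by rewrite EFinD EFinM leeD2r// lee_wpmul2l// lee_fin ltW.
have DY : D + Y <= (C2 * V `^ p + c)%:E.
  rewrite /Y (integral_kernel_mixture piE)//.
  rewrite /D -(coupling_integral_fst cg)//; last by move=> x; exact: ge0_int.
  rewrite -(coupling_integral_snd cg)//; last by move=> x; exact: ge0_int.
  have mKM : measurable_fun setT
      (fun z : T * T => ((K * mdist z.1 z.2 + M) `^ p)%:E).
    apply/measurable_EFinP; apply: measurableT_comp (measurable_powR _) _.
    apply: measurable_funD => //; apply: measurable_funM => //.
    exact: measurable_mdist2.
  have m1 : measurable_fun setT
      (fun z : T * T => \int[transition P z.1]_y (chin y)%:E).
    exact: measurableT_comp mPn measurable_fst.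
  have m2 : measurable_fun setT
      (fun z : T * T => \int[transition P z.2]_y (h y)%:E).
    exact: measurableT_comp mPh measurable_snd.
  rewrite -ge0_integralD//; last 2 first.
  - by move=> x _; exact: ge0_int.
  - by move=> x _; exact: ge0_int.
  have KMp0 (z : T * T) : setT z -> 0 <= ((K * mdist z.1 z.2 + M) `^ p)%:E.
    by move=> _; rewrite lee_fin powR_ge0.
  apply: (@le_trans _ _ (\int[g]_z
      (C2%:E * ((K * mdist z.1 z.2 + M) `^ p)%:E + c%:E))).
    apply: ge0_le_integral => //.
    - by move=> x _; rewrite adde_ge0// ge0_int.
    - exact: emeasurable_funD.
    - by apply: emeasurable_funD => //; exact: measurable_funeM.
    - move=> z _; rewrite -EFinM -EFinD.
      apply: (wasserstein_dual_le p1 C20 c0 (KM0 _ _)) (P_lip _ _) => //.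
  rewrite ge0_integralD//; last 2 first.
  - by move=> x _; rewrite mule_ge0// KMp0.
  - exact: measurable_funeM.
  rewrite ge0_integralZl_EFin// integral_probability_cst.
  by rewrite EFinD EFinM leeD2r// lee_wpmul2l.
have AD : A + D = b%:E.
  rewrite /A /D -ge0_integralD//; last 2 first.
  - by move=> x _; exact: ge0_int.
  - by move=> x _; exact: ge0_int.
  rewrite -[RHS](integral_probability_cst nu0); apply: eq_integral => x _.
  rewrite -[RHS](integral_probability_cst (transition P x)) -ge0_integralD//.
  by apply: eq_integral => y _; rewrite -EFinD /chip /chin; congr EFin; ring.
have X0 : 0 <= X by exact: ge0_int.
have Y0 : 0 <= Y by exact: ge0_int.
have A0 : 0 <= A by apply: integral_ge0 => x _; exact: ge0_int.
have D0 : 0 <= D by apply: integral_ge0 => x _; exact: ge0_int.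
rewrite -/X -/Y -(split_weightE p1 U0 V0) -/C1 -/C2.
move: X Y A D X0 Y0 A0 D0 XA DY AD => [x| |] [y| |] [a| |] [t| |] //=.
by move=> _ _ _ _; rewrite -!EFinD !lee_fin => ? ? [?]; lra.
Qed.

End markov_transport.

Lemma sqrt_cauchy_schwarz {R : realType} (A J K e0 e1 H : R) :
  0 <= A -> 0 <= J -> 0 <= K -> 0 <= e0 -> 0 <= e1 -> e0 + e1 <= H ->
  Num.sqrt (2 * A * e1) + K * Num.sqrt (2 * J * e0) <=
  Num.sqrt (2 * (A + K ^+ 2 * J) * H).
Proof.
move=> A0 J0 K0 e00 e10 eH.
have K20 : 0 <= K ^+ 2 by exact: sqr_ge0.
have s0 : 0 <= Num.sqrt (2 * A * e1) + K * Num.sqrt (2 * J * e0).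
  by rewrite addr_ge0 ?mulr_ge0 ?sqrtr_ge0.
rewrite -[leLHS]ger0_norm// -sqrtr_sqr; apply: ler_wsqrtr.
apply: (@le_trans _ _ (2 * (A + K ^+ 2 * J) * (e0 + e1))); last first.
  by rewrite ler_wpM2l// mulr_ge0// addr_ge0// mulr_ge0.
have a2 : Num.sqrt (2 * A * e1) ^+ 2 = 2 * A * e1 by rewrite sqr_sqrtr ?mulr_ge0.
have b2 : Num.sqrt (2 * J * e0) ^+ 2 = 2 * J * e0 by rewrite sqr_sqrtr ?mulr_ge0.
rewrite sqrrD exprMn a2 b2.
have -> : Num.sqrt (2 * A * e1) * (K * Num.sqrt (2 * J * e0)) =
    (Num.sqrt (2 * A * e0)) * (K * Num.sqrt (2 * J * e1)).
  rewrite mulrCA -sqrtrM ?mulr_ge0// [RHS]mulrCA -sqrtrM ?mulr_ge0//.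
  by congr (_ * Num.sqrt _); ring.
have c2 : Num.sqrt (2 * A * e0) ^+ 2 = 2 * A * e0 by rewrite sqr_sqrtr ?mulr_ge0.
have d2 : Num.sqrt (2 * J * e1) ^+ 2 = 2 * J * e1 by rewrite sqr_sqrtr ?mulr_ge0.
move: c2 d2; set c := Num.sqrt (2 * A * e0); set b := Num.sqrt (2 * J * e1).
move=> c2 d2.
have := sqr_ge0 (c - K * b); rewrite sqrrB exprMn c2 d2.
clearbody c b; lra.
Qed.

Section one_step.
Local Open Scope ereal_scope.
Context {R : realType} d (T : polishMetricType R d).
Variables (p : R) (p1 : (1 <= p)%R) (p2 : (p <= 2)%R).
Variables (P : R.-pker T ~> T) (K M A B : R).
Hypotheses (K01 : (0 <= K <= 1)%R) (M0 : (0 <= M)%R).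
Hypotheses (A0 : (0 <= A)%R) (B0 : (0 <= B)%R).
Hypothesis P_lip : forall x y : T,
  wasserstein p (transition P x) (transition P y) <= (K * mdist x y + M)%:E.
Hypothesis P_TpH : forall x, TpH p A B (transition P x).

Let dp0 (x y : T) : 0 <= ((mdist x y) `^ p)%:E.
Proof. by rewrite lee_fin powR_ge0. Qed.

Let mdp (x : T) := measurable_mdist_powR p x.

(** The law [pi] is only required to agree with [mu0 P] on measurable sets,
    so that the lemma also applies to the powers of the kernel. The slack [dl]
    makes the bounds [U] and [V] of the two legs positive and leaves room for
    an almost optimal coupling; it enters five times, with a factor at most
    [1]. *)
Lemma TpH_step (J S : R) (mu0 pi : probability T R) :
  (0 <= J)%R -> (0 <= S)%R -> TpH p J S mu0 ->
  (forall E, measurable E -> pi E = \int[mu0]_x P x E) ->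
  TpH p (A + K ^+ 2 * J) (K * S + B + M) pi.
Proof.
move=> J0 S0 [[x0 mu0fin] mu0T] piE.
have K0 : (0 <= K)%R by case/andP: K01.
have p_ge0 : (0 <= p)%R by exact: le_trans p1.
have pifin : \int[pi]_x ((mdist x0 x) `^ p)%:E < +oo.
  rewrite (integral_kernel_mixture piE)//.
  exact: (kernel_moment p1 p2 K01 M0 P_lip (P_TpH x0).1).
split; first by exists x0.
move=> nu.
have [Hoo|Hoo] := eqVneq (relative_entropy nu pi) +oo.
  by rewrite /sqrt_entropy Hoo eqxx addye// leey.
have Hlty : relative_entropy nu pi < +oo by rewrite ltey.
have [nu0 [Q [h [e0 [e1 [nu0E [mh h0 inth] [e00 e10 e01] QE nuE]]]]]] :=
  entropy_disintegration piE Hlty.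
have Hfin : relative_entropy nu pi \is a fin_num.
  by rewrite fin_numE Hoo andbT gt_eqF// (lt_le_trans _ e01)// ltNyr.
rewrite /sqrt_entropy (negbTE Hoo) -EFinD.
move: e01; rewrite -{1}(fineK Hfin) lee_fin => e01.
set H := fine _ in e01 *.
pose w0 := (Num.sqrt (2 * J * e0) + S)%R.
have w00 : (0 <= w0)%R by rewrite addr_ge0// sqrtr_ge0.
have Ww0 : wasserstein p nu0 mu0 <= w0%:E.
  by have := mu0T nu0; rewrite nu0E /sqrt_entropy.
pose w x := (Num.sqrt (2 * A * h x) + B)%R.
have m2Ah : measurable_fun setT (fun x => 2 * A * h x)%R.
  exact: measurable_funM.
have h2A x : (0 <= 2 * A * h x)%R by rewrite !mulr_ge0.
have msq : measurable_fun setT (fun x => Num.sqrt (2 * A * h x)).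
  under eq_fun do rewrite -powR12_sqrt//.
  exact: measurableT_comp (measurable_powR _) m2Ah.
have mw : measurable_fun setT w by exact: measurable_funD.
have w_ge0 x : (0 <= w x)%R by rewrite addr_ge0// sqrtr_ge0.
have Qw : {ae nu0, forall x, wasserstein p (Q x) (transition P x) <= (w x)%:E}.
  apply: filterS QE => x Qx; have [_ /(_ (Q x))] := P_TpH x.
  by rewrite Qx /sqrt_entropy.
have KM0 (z : T * T) : (0 <= K * mdist z.1 z.2 + M)%R.
  by rewrite addr_ge0// mulr_ge0// mdist_ge0.
apply/lee_addgt0Pr => e e_gt0.
pose dl := (e / 5)%R; have dl0 : (0 < dl)%R by rewrite divr_gt0.
pose U := ((Num.sqrt (2 * A * e1) + dl) + (B + dl))%R.
pose V := ((K * (w0 + dl) + dl) + (M + dl))%R.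
have sA0 := sqrtr_ge0 (2 * A * e1).
have U0 : (0 < U)%R by rewrite addr_gt0// ?ltr_wpDl.
have V0 : (0 < V)%R.
  by rewrite addr_gt0// ltr_wpDl// mulr_ge0// addr_ge0// ltW.
have wU : \int[nu0]_x ((w x) `^ p)%:E <= (U `^ p)%:E.
  apply: minkowski_le => //.
  - by rewrite ltr_wpDl.
  - by rewrite ltr_wpDl.
  - apply: jensen_sqrt_le => //; first by rewrite ltr_wpDl.
    under eq_integral do rewrite EFinM.
    rewrite ge0_integralZl_EFin//; last 3 first.
    + by move=> x _; rewrite lee_fin.
    + exact/measurable_EFinP.
    + by rewrite mulr_ge0.
    rewrite inth -EFinM lee_fin -[leLHS]sqr_sqrtr ?mulr_ge0//.
    by rewrite ler_sqr ?nnegrE ?addr_ge0 ?lerDl// ltW.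
  - rewrite integral_probability_cst lee_fin; apply: ge0_ler_powR => //.
    + by rewrite nnegrE addr_ge0// ltW.
    + by rewrite lerDl ltW.
have [|g cg gle] :=
    wasserstein_coupling_lt p1 (c := (w0 + dl) `^ p) w00 Ww0.
  apply: gt0_ltr_powR; rewrite ?nnegrE ?ltrDl//.
  + exact: lt_le_trans p1.
  + by rewrite addr_ge0// ltW.
have md2 : measurable_fun setT (fun z : T * T => mdist z.1 z.2).
  exact: measurable_mdist2.
have gV : \int[g]_z ((K * mdist z.1 z.2 + M) `^ p)%:E <= (V `^ p)%:E.
  apply: (@minkowski_le _ _ _ _ _ p1 (fun z : T * T => K * mdist z.1 z.2)%R
    (cst M)) => //.
  - exact: measurable_funM.
  - by move=> z; rewrite mulr_ge0// mdist_ge0.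
  - by rewrite ltr_wpDl// mulr_ge0// addr_ge0// ltW.
  - by rewrite ltr_wpDl.
  - under eq_integral do rewrite powRM ?mdist_ge0// EFinM.
    rewrite ge0_integralZl_EFin//; last 2 first.
    + exact: measurable_mdist2_powR.
    + exact: powR_ge0.
    apply: (@le_trans _ _ ((K `^ p)%:E * ((w0 + dl) `^ p)%:E)).
      by rewrite lee_wpmul2l// lee_fin powR_ge0.
    have wd0 : (0 <= w0 + dl)%R by rewrite addr_ge0// ltW.
    rewrite -EFinM -powRM// lee_fin; apply: ge0_ler_powR => //.
    + by rewrite nnegrE mulr_ge0.
    + by rewrite nnegrE addr_ge0 ?mulr_ge0// ltW.
    + by rewrite lerDl ltW.
  - rewrite [leLHS](integral_probability_cst g (M `^ p)) lee_fin; apply: ge0_ler_powR => //.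
    + by rewrite nnegrE addr_ge0// ltW.
    + by rewrite lerDl ltW.
have nu0fin : \int[nu0]_x ((mdist x0 x) `^ p)%:E < +oo.
  apply: (le_lt_trans (moment_le p1 x0 p2 w00 Ww0)).
  by rewrite lte_mul_pinfty// lte_add_pinfty// ltry.
have nufin : \int[nu]_x ((mdist x0 x) `^ p)%:E < +oo.
  have [mQd ->] := nuE _ (mdp x0) (dp0 x0).
  have PP := kernel_moment p1 p2 K01 M0 P_lip (P_TpH x0).1 nu0fin.
  have mP := measurable_integral_transition P (mdp x0) (dp0 x0).
  have mwp : measurable_fun setT (fun x => ((w x) `^ p + 1)%:E).
    apply/measurable_EFinP; apply: measurable_funD => //.
    exact: measurableT_comp (measurable_powR _) mw.
  have iP0 x : 0 <= \int[transition P x]_y ((mdist x0 y) `^ p)%:E.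
    exact: integral_ge0.
  have wp0 x : 0 <= ((w x) `^ p + 1)%:E by rewrite lee_fin addr_ge0// powR_ge0.
  apply: (@le_lt_trans _ _ (\int[nu0]_x (2%:E *
      (\int[transition P x]_y ((mdist x0 y) `^ p)%:E + ((w x) `^ p + 1)%:E)))).
    apply: ae_ge0_le_integral => //.
    - by move=> x _; exact: integral_ge0.
    - by move=> x _; rewrite mule_ge0// adde_ge0.
    - by apply: measurable_funeM; exact: emeasurable_funD.
    - by apply: filterS Qw => x Qwx _; exact: moment_le.
  rewrite ge0_integralZl_EFin//; last 2 first.
  - by move=> x _; rewrite adde_ge0.
  - exact: emeasurable_funD.
  rewrite ge0_integralD// lte_mul_pinfty// lte_add_pinfty//.
  under eq_integral do rewrite EFinD.
  rewrite ge0_integralD//; last 2 first.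
  - by move=> x _; rewrite lee_fin powR_ge0.
  - by apply/measurable_EFinP; exact: measurableT_comp (measurable_powR _) mw.
  rewrite (integral_probability_cst nu0 1) lte_add_pinfty ?ltry//.
  exact: le_lt_trans wU (ltry _).
apply: (le_trans (wasserstein_mixture_le p1 p2 K01 M0 P_lip piE nuE cg mw w_ge0
  Qw U0 V0 wU gV nufin pifin)).
rewrite -EFinD lee_fin.
have := sqrt_cauchy_schwarz A0 J0 K0 e00 e10 e01.
have Kd : (K * dl <= dl)%R.
  by apply: ler_piMl; [exact: ltW|case/andP: K01].
have dlE : (5 * dl = e)%R by rewrite /dl; field.
by rewrite /U /V /w0 mulrDr mulrDr; lra.
Qed.

End one_step.

(** * Iteration of the kernel *)

Lemma kstep_kpowSE {R : realType} d (T : measurableType d)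
    (P : R.-pker T ~> T) (mu : probability T R) n (E : set T) :
  measurable E ->
  (kstep mu (kpow P n.+1) E = \int[kstep mu (kpow P n)]_x P x E)%E.
Proof.
move=> mE; rewrite (@integral_kernel_mixture _ _ _ (kpow P n) mu)//.
exact: measurable_kernel.
Qed.

Lemma kstep_kpow1E {R : realType} d (T : measurableType d)
    (P : R.-pker T ~> T) (mu : probability T R) (E : set T) :
  measurable E -> (kstep mu (kpow P 1) E = \int[mu]_x P x E)%E.
Proof.
move=> mE; apply: eq_integral => x _.
transitivity (\int[dirac x]_y P y E)%E; first by [].
by rewrite integral_dirac ?diracT ?mul1e//; exact: measurable_kernel.
Qed.

(** [1 + q + ... + q ^ (n - 1)] in closed form. *)
Definition geom_sum {R : realType} (q : R) (n : nat) : R :=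
  if q == 1 then n%:R else (1 - q ^+ n) / (1 - q).

Lemma geom_sum0 {R : realType} (q : R) : geom_sum q 0 = 0.
Proof. by rewrite /geom_sum expr0 subrr mul0r if_same. Qed.

Lemma geom_sumS {R : realType} (q : R) n :
  geom_sum q n.+1 = 1 + q * geom_sum q n.
Proof.
rewrite /geom_sum; case: eqVneq => [->|q1]; first by rewrite mul1r -natr1 addrC.
by rewrite exprS; field; rewrite subr_eq0 eq_sym.
Qed.

Lemma geom_sum_ge0 {R : realType} (q : R) n :
  0 <= q -> 0 <= geom_sum q n.
Proof.
by move=> q0; elim: n => [|n IH]; rewrite ?geom_sum0// geom_sumS addr_ge0 ?mulr_ge0.
Qed.

Unset Implicit Arguments.

Theorem theorem2p4 (R : realType) (d : measure_display)
    (T : polishMetricType R d) (P : R.-pker T ~> T)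
    (p : R) (hp : 1 <= p <= 2)
    (K M : R) (hK : 0 <= K <= 1) (hM : 0 <= M)
    (hP : forall x y : T,
      (wasserstein p (transition P x) (transition P y)
        <= (K * mdist x y + M)%:E)%E)
    (A B : R) (hA : 0 <= A) (hB : 0 <= B)
    (hAB : forall x : T, TpH p A B (transition P x))
    (J S : R) (hJ : 0 <= J) (hS : 0 <= S)
    (mu0 : probability T R) (hmu0 : TpH p J S mu0) :
  TpH p (A + K ^+ 2 * J) (K * S + B + M) (kstep mu0 P) /\
  (forall N : nat, (1 <= N)%N ->
    TpH p
      (K ^+ (2 * N) * J
        + A * (if K == 1 then N%:R else (1 - K ^+ (2 * N)) / (1 - K ^+ 2)))
      (K ^+ N * S
        + (B + M) * (if K == 1 then N%:R else (1 - K ^+ N) / (1 - K)))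
      (kstep mu0 (kpow P N))).
Proof.
case/andP: hp => p1 p2; have K0 : 0 <= K by case/andP: hK.
have K20 : 0 <= K ^+ 2 by exact: exprn_ge0.
have step := TpH_step p1 p2 hK hM hA hB hP hAB.
split; first by apply: (step _ _ mu0).
have K21 : (K == 1) = (K ^+ 2 == 1).
  by rewrite sqrf_eq1 [K == -1]gt_eqF ?orbF// (lt_le_trans _ K0)// ltrN10.
move=> N N1.
rewrite exprM {1}K21 -/(geom_sum (K ^+ 2) N) -/(geom_sum K N).
case: N N1 => // N _; elim: N => [|N IH].
  rewrite !geom_sumS !geom_sum0 !mulr0 !addr0 !mulr1 !expr1 addrA.
  rewrite [_ * J + A]addrC; apply: (step _ _ _ _ hJ hS hmu0) => E mE; exact: kstep_kpow1E.
set J' := _ + A * _ in IH; set S' := _ + (B + M) * _ in IH.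
have J'0 : 0 <= J' by rewrite addr_ge0 ?mulr_ge0 ?geom_sum_ge0 ?exprn_ge0.
have S'0 : 0 <= S' by rewrite addr_ge0 ?mulr_ge0 ?geom_sum_ge0 ?addr_ge0 ?exprn_ge0.
have -> : (K ^+ 2) ^+ N.+2 * J + A * geom_sum (K ^+ 2) N.+2 =
    A + K ^+ 2 * J' by rewrite geom_sumS [_ ^+ N.+2]exprS /J'; ring.
have -> : K ^+ N.+2 * S + (B + M) * geom_sum K N.+2 =
    K * S' + B + M by rewrite geom_sumS [_ ^+ N.+2]exprS /S'; ring.
by apply: (step _ _ _ _ J'0 S'0 IH) => E mE; exact: kstep_kpowSE.
Qed.
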